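(* Let $q\in(0,1)$ and $\nu>-1$. Then the radius of starlikeness $r^*\left(h_{\nu}^{(2)}(\cdot;q)\right)$ of the function $$z\mapsto h_{\nu}^{(2)}(z;q)=2^{\nu}c_{\nu}(q)z^{1-\frac{\nu}{2}}J_{\nu}^{(2)}(\sqrt{z};q)$$ is the smallest positive root of the equation $r\cdot \frac{d}{dr}J_{\nu}^{(2)}(r;q)-(\nu-2)J_{\nu}^{(2)}(r;q)=0$ and satisfies $$\frac{2(1-q)(1-q^{\nu+1})}{q^{\nu+1}}<r^*\left(h_{\nu}^{(2)}(\cdot;q)\right)< \frac{4(q^{\nu+1}-1)(q^{\nu+2}-1)(1-q^2)}{q^{\nu+1}\left(2q-2q^{\nu+2}+q^{\nu+3}-3q^2+2\right)}$$ and $$\sqrt{\frac{8(q^{\nu+1}-1)^2(1-q^{\nu+2})(q-1)^2(q+1)}{q^{2\nu+2}\left(2q-2q^{\nu+2}+q^{\nu+3}-3q^2+2\right)}}< r^*\left(h_{\nu}^{(2)}(\cdot;q)\right)<\frac{4(q^{\nu+1}-1)(q^{\nu+3}-1)(q^3-1)}{q^{\nu+1}}\,q_2^*(\nu),$$ where $$q_2^*(\nu)=\frac{2q-2q^{\nu+2}+q^{\nu+3}-3q^2+2}{c_{\nu}(q)+d_{\nu}(q)},$$ $$c_{\nu}(q)=4q^{\nu+2}+3q^{\nu+3}+7q^{\nu+4}-6q^{\nu+5}-5q^{\nu+6}+3q^{\nu+7}-4q^{2\nu+5}+q^{2\nu+6},$$ $$d_{\nu}(q)=q^{2\nu+7}-q^{2\nu+8}-8q+q^2+5q^3+9q^4-6q^6-4.$$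 (Here $c_\nu(q)$ in the definition of $q_2^*$ denotes the displayed polynomial, not the normalizing constant.)
   Context: For $a\in\mathbb{C}$ and $q\in(0,1)$: $(a;q)_0=1$, $(a;q)_n=\prod_{k=1}^{n}(1-aq^{k-1})$, $(a;q)_\infty=\prod_{k\geq1}(1-aq^{k-1})$. The Jackson $q$-Bessel function is, for $\nu>-1$, $$J_{\nu}^{(2)}(z;q)=\frac{(q^{\nu+1};q)_{\infty}}{(q;q)_{\infty}}\sum_{n\geq0}\frac{(-1)^{n}\left(\frac{z}{2}\right)^{2n+\nu}}{(q;q)_{n}(q^{\nu+1};q)_{n}}q^{n(n+\nu)}.$$ In the definition of $h_\nu^{(2)}$, the constant $c_{\nu}(q)=(q;q)_{\infty}/(q^{\nu+1};q)_{\infty}$; thus $h_\nu^{(2)}(z;q)=\sum_{n\ge0}\frac{(-1)^n q^{n(n+\nu)}}{2^{2n}(q;q)_n(q^{\nu+1};q)_n}z^{n+1}$ is entire with $h(0)=0$, $h'(0)=1$. For such $f$, the radius of starlikeness is $r^*(f)=\sup\{r>0:\ \mathrm{Re}\,(zf'(z)/f(z))>0 \text{ for all } |z|<r\}$.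
   Formalization: The radius of starlikeness is proved to be the square of the smallest positive root of the displayed equation, not the root itself, since the equation is satisfied by √z; as printed the claim fails, e.g. at q=1/10, ν=0. All four bounds on r* are as stated. *)

(* Defs.v *)
From Stdlib Require Import Reals.
From Coquelicot Require Import Coquelicot.
Open Scope R_scope.

Fixpoint qpoch (a q : R) (n : nat) : R :=
  match n with
  | O => 1
  | S k => qpoch a q k * (1 - a * q ^ k)
  end.

Definition qpoch_inf (a q : R) : R := real (Lim_seq (fun n => qpoch a q n)).

Definition jackson_J2 (nu q x : R) : R :=
  qpoch_inf (Rpower q (nu + 1)) q / qpoch_inf q q *
  Series (fun n : nat =>
    (-1) ^ n * Rpower (x / 2) (2 * INR n + nu) *
    Rpower q (INR n * (INR n + nu)) /
    (qpoch q q n * qpoch (Rpower q (nu + 1)) q n)).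

Definition CSeries (a : nat -> C) : C :=
  (Series (fun n => Re (a n)), Series (fun n => Im (a n))).

Fixpoint Cpow (z : C) (n : nat) : C :=
  match n with
  | O => RtoC 1
  | S k => Cmult (Cpow z k) z
  end.

Definition h_nu2 (nu q : R) (z : C) : C :=
  CSeries (fun n : nat =>
    Cmult (RtoC ((-1) ^ n * Rpower q (INR n * (INR n + nu)) /
                 (2 ^ (2 * n) * qpoch q q n * qpoch (Rpower q (nu + 1)) q n)))
          (Cpow z (S n))).

(* Radius of starlikeness: sup of r > 0 such that Re(z f'(z)/f(z)) > 0 on the
   punctured disc 0 < |z| < r (at z = 0 the quotient equals 1 by continuity,
   since f(0)=0, f'(0)=1).  f'(z) is the complex derivative. *)
Definition radius_starlike (f : C -> C) : Rbar :=
  Lub_Rbar (fun r => 0 < r /\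
    forall z : C, 0 < Cmod z < r ->
      exists l : C, @is_derive C_AbsRing C_NormedModule f z l /\
        0 < Re (Cdiv (Cmult z l) (f z))).

Definition cpoly (nu q : R) : R :=
  4 * Rpower q (nu + 2) + 3 * Rpower q (nu + 3) + 7 * Rpower q (nu + 4)
  - 6 * Rpower q (nu + 5) - 5 * Rpower q (nu + 6) + 3 * Rpower q (nu + 7)
  - 4 * Rpower q (2 * nu + 5) + Rpower q (2 * nu + 6).

Definition dpoly (nu q : R) : R :=
  Rpower q (2 * nu + 7) - Rpower q (2 * nu + 8) - 8 * q + q ^ 2 + 5 * q ^ 3
  + 9 * q ^ 4 - 6 * q ^ 6 - 4.

Definition Dpoly (nu q : R) : R :=
  2 * q - 2 * Rpower q (nu + 2) + Rpower q (nu + 3) - 3 * q ^ 2 + 2.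

Definition q2star (nu q : R) : R := Dpoly nu q / (cpoly nu q + dpoly nu q).

(* Main.v *)
From mathcomp Require all_boot all_order all_algebra complex Rstruct ring lra.
Require Import Defs.
From Stdlib Require Import Reals Lra Lia List Psatz Ranalysis5.
From Coquelicot Require Import Coquelicot.
Open Scope R_scope.

(** Write [h(z) = z F(z)] with [F(z) = sum f_n z^n] and [Q = q^(nu+1)].  The function [F = F_Q]
    satisfies [F_Q(z) = F_(Qq)(z) - c(Q) z F_(Qqq)(z)] with [c(Q) > 0], so its Taylor coefficients
    are limits of those of the continuants attached to the chain [c(Q), c(Qq), c(Qqq), ...].
    A Pick-function argument shows that every zero of such a continuant is real, hence positive,
    and the continuant is a finite product of factors [1 - x z] with [x > 0].  In the limit
    the Rayleigh sums [p_k] (the coefficients of [P = - z F' / F]) inherit from power sums: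
    [0 <= p_k], log-convexity, and [p_k <= (sqrt p_2)^k].

    Since [z h'/h = 1 - P] with [p_k >= 0], the minimum of [Re (z h'/h)] on [|z| = r] is
    [1 - P(r)], and the radius of starlikeness is the root [r] of [P(r) = 1], that is, the first
    zero of [h' = F (1 - P)].  The Euler-Rayleigh bounds compare [P] with the geometric series
    [p_1 z + sum_(k >= 2) (sqrt p_2 z)^k] from above and
    [p_1 z + p_2 z^2 sum_k (p_3 / p_2 z)^k] from below: the power sums of the reciprocal zeros of
    [h'] are [2 p_1], [p_1^2 + 3 p_2] and [p_1^3 + 3 p_1 p_2 + 4 p_3]. *)

(** * Continuants with positive coefficients *)

Definition shift (a : nat -> R) (k : nat) : R :=
  match k with O => 0 | S m => a m end.

(** Coefficients of the polynomial prod (1 - x z), [x] in [l]. The entries of [l] are thus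
    reciprocals of zeros, and their power sums are Rayleigh sums. *)
Fixpoint prod_coef (l : list R) (k : nat) : R :=
  match l with
  | nil => match k with O => 1 | S _ => 0 end
  | cons x l' => prod_coef l' k - x * shift (prod_coef l') k
  end.

(** Coefficients of the continuants K_(N+1,j) = K_(N,j+1) - c_j z K_(N-1,j+2). At [N] = 1 the
    truncation in [pred] supplies the second initial value 1, so that K_(1,j) = 1 - c_j z. *)
Fixpoint cont_coef (c : nat -> R) (N j k : nat) {struct N} : R :=
  match N with
  | O => match k with O => 1 | S _ => 0 end
  | S M => cont_coef c M (S j) k - c j * shift (cont_coef c (pred M) (S (S j))) k
  end.

Module Continuant.
Import all_boot all_order all_algebra complex ring lra.
Import Order.TTheory GRing.Theory Num.Theory.
Local Open Scope ring_scope.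
Local Open Scope complex_scope.

Set Implicit Arguments.
Unset Strict Implicit.
Unset Printing Implicit Defensive.

Fixpoint cont_poly {K : nzRingType} (c : nat -> K) (N j : nat) : {poly K} :=
  if N is M.+1 then cont_poly c M j.+1 - c j *: ('X * cont_poly c M.-1 j.+2) else 1.

Lemma cont_polyS (K : nzRingType) (c : nat -> K) (N j : nat) :
  cont_poly c N.+1 j = cont_poly c N j.+1 - c j *: ('X * cont_poly c N.-1 j.+2).
Proof. by []. Qed.

Lemma cont_poly_at_0 (K : comNzRingType) (c : nat -> K) (N j : nat) :
  (cont_poly c N j).[0] = 1.
Proof.
elim: N j => [|N IH] j; first by rewrite /= hornerC.
by rewrite cont_polyS !hornerE IH /= mulr0 mul0r subr0.
Qed.

(** For [x] <= 0 every step of the recursion subtracts a nonpositive term, so the values never drop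
    below the initial 1. This excludes nonpositive real roots. *)
Lemma cont_poly_ge1 (K : realFieldType) (c : nat -> K) (x : K) (N j : nat) :
  (forall i, 0 < c i) -> x <= 0 -> 1 <= (cont_poly c N j).[x].
Proof.
move=> c_gt0 x_le0; elim/ltn_ind: N j => -[|N] IH j; first by rewrite /= hornerC.
rewrite cont_polyS !hornerE /=.
have h1 := IH N (ltnSn N) j.+1.
have h2 : 1 <= (cont_poly c N.-1 j.+2).[x] by apply: IH; rewrite ltnS leq_pred.
have : c j * x * (cont_poly c N.-1 j.+2).[x] <= 0.
  by rewrite -mulrA pmulr_rle0 // mulr_le0_ge0 // (le_trans ler01).
lra.
Qed.

(* Both quantities are the numerators of [Im R] and [Im (w * R)], where [R] is the
   quotient of two consecutive continuants: [R] stays a Pick function. *)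
Lemma cont_poly_pick (K : rcfType) (c : nat -> K) (w : K[i]) (N j : nat) :
  (forall i, 0 < c i) -> 0 < complex.Im w ->
  let e M k := (map_poly (real_complex K) (cont_poly c M k)).[w] in
  0 <= complex.Im (e N.-1 j.+1 * (e N j)^*) /\ 0 < complex.Im (w * e N.-1 j.+1 * (e N j)^*).
Proof.
move=> c_gt0 w_gt0 e.
have e0 k : e 0 k = 1 by rewrite /e /= rmorph1 hornerC.
have eS M k : e M.+1 k = e M k.+1 - (c k)%:C * (w * e M.-1 k.+2).
  by rewrite /e cont_polyS rmorphB /= map_polyZ rmorphM /= map_polyX !hornerE /= -mulrA.
elim: N j => [|N IH] j.
  by rewrite !e0; case: w w_gt0 {e e0 eS} => x y /= y_gt0; split; lra.
rewrite /= eS; have [] := IH j.+1.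
move: (e N j.+1) (e N.-1 j.+2) (c j) (c_gt0 j) => [a b] [a' b'] d d_gt0.
case: w w_gt0 {e e0 eS IH} => x y /= y_gt0.
(* [A] and [B] are the two imaginary parts of the induction hypothesis. Expanding the recursion
   turns the new first one into d B, and the new second one into |e|^2 Im w + d |w|^2 A, where e = a
   + i b. *)
set A := a' * - b + b' * a; set B := (X in 0 < X -> _) => A_ge0 B_gt0.
split.
  have -> : a * - (b + - (d * (x * b' + y * a') + 0 * (x * a' - y * b'))) +
     b * (a - (d * (x * a' - y * b') - 0 * (x * b' + y * a'))) = d * B.
    by rewrite /B; ring.
  exact/ltW/mulr_gt0.
(* The continuant a + i b cannot vanish, because [B] would vanish with it. *)
have ab_gt0 : 0 < a ^+ 2 + b ^+ 2.
  rewrite lt_def addr_ge0 ?sqr_ge0 // andbT paddr_eq0 ?sqr_ge0 // !sqrf_eq0.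
  by apply: contraTN B_gt0 => /andP[/eqP a0 /eqP b0]; rewrite /B a0 b0 oppr0 !mulr0 addr0 ltxx.
have -> : (x * a - y * b) * - (b + - (d * (x * b' + y * a') + 0 * (x * a' - y * b'))) +
     (x * b + y * a) * (a - (d * (x * a' - y * b') - 0 * (x * b' + y * a'))) =
     (a ^+ 2 + b ^+ 2) * y + d * (x ^+ 2 + y ^+ 2) * A.
  by rewrite /A; ring.
apply: ltr_pwDl; first exact: mulr_gt0.
by rewrite mulr_ge0 // mulr_ge0 ?addr_ge0 ?sqr_ge0 // ltW.
Qed.

(** A root in the open upper half plane would make the strictly positive quantity of
    [cont_poly_pick] zero. The lower half plane follows by conjugation, since the coefficients are
    real. *)
Lemma cont_poly_root_real (K : rcfType) (c : nat -> K) (w : K[i]) (N : nat) :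
  (forall i, 0 < c i) -> root (map_poly (real_complex K) (cont_poly c N 0)) w -> complex.Im w = 0.
Proof.
move=> c_gt0 rw.
have noroot v : 0 < complex.Im v -> ~~ root (map_poly (real_complex K) (cont_poly c N 0)) v.
  move=> v_gt0; apply/negP => /eqP e0.
  by have [_] := cont_poly_pick N 0 c_gt0 v_gt0; rewrite e0 rmorph0 mulr0 ltxx.
case: (ltrgtP (complex.Im w) 0) => // [w_lt0|/noroot]; last by rewrite rw.
have /negP[] : ~~ root (map_poly (real_complex K) (cont_poly c N 0)) w^*.
  by apply: noroot; case: w w_lt0 {rw} => x y /=; rewrite oppr_gt0.
have := rw; rewrite -(fmorph_root (@conjc K)) -map_poly_comp.
rewrite (eq_map_poly (g := real_complex K)) // => x.
by rewrite /= oppr0.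
Qed.

(** The polynomial splits over [K[i]]; its roots are real by [cont_poly_root_real] and positive by
    [cont_poly_ge1]. The list consists of their inverses, and the value 1 at 0 fixes the scalar
    factor. *)
Lemma cont_poly_factor (K : rcfType) (c : nat -> K) (N : nat) :
  (forall i, 0 < c i) ->
  {s : seq K | all (fun x => 0 < x) s &
     cont_poly c N 0 = \prod_(x <- s) (1 - x *: 'X)}.
Proof.
move=> c_gt0.
set p := cont_poly c N 0.
have [r pE] := closed_field_poly_normal (map_poly (real_complex K) p).
have p0 : p != 0.
  apply: contraTneq isT => p0; have := cont_poly_at_0 c N 0.
  by rewrite -/p p0 horner0 => /eqP; rewrite eq_sym oner_eq0.
have lc0 : lead_coef (map_poly (real_complex K) p) != 0.
  by rewrite lead_coef_map fmorph_eq0 lead_coef_eq0.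
have r_root z : z \in r -> root (map_poly (real_complex K) p) z.
  by rewrite pE rootZ // root_prod_XsubC.
have r_re z : z \in r -> z = (complex.Re z)%:C.
  by move=> /r_root /(cont_poly_root_real c_gt0); case: z => x y /= ->.
have pE' : p = lead_coef p *: \prod_(z <- map (@complex.Re K) r) ('X - z%:P).
  apply: (map_poly_inj (real_complex K)); rewrite pE lead_coef_map map_polyZ rmorph_prod big_map.
  congr (_ *: _); rewrite big_seq [RHS]big_seq; apply: eq_bigr => z /r_re zE.
  by rewrite rmorphB /= map_polyX map_polyC /= -zE.
have root_gt0 z : z \in map (@complex.Re K) r -> 0 < z.
  move=> zr; rewrite ltNge; apply/negP => z_le0.
  have := cont_poly_ge1 N 0 c_gt0 z_le0; rewrite -/p pE'.
  by rewrite hornerZ (rootP _) ?mulr0 ?ler10 // root_prod_XsubC.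
exists (map (fun z => z^-1) (map (@complex.Re K) r)).
  by apply/allP => _ /mapP[z zr ->]; rewrite invr_gt0 root_gt0.
have := cont_poly_at_0 c N 0; rewrite -/p pE'.
(* The scalar is generalized because rewriting X - z as -z (1 - X / z) changes it from [a] to - a z.
   When the list is exhausted, evaluation at 0 shows that it is 1. *)
move: (lead_coef p) root_gt0; elim: (map (@complex.Re K) r) => [|z s IH] a s_gt0.
  by rewrite !big_nil hornerZ hornerC mulr1 => ->; rewrite scale1r.
rewrite /= !big_cons => pz.
have z_gt0 := s_gt0 z (mem_head _ _).
have -> : a *: (('X - z%:P) * \prod_(j <- s) ('X - j%:P)) =
   (1 - z^-1 *: 'X) * ((- (a * z)) *: \prod_(j <- s) ('X - j%:P)).
  rewrite -[in RHS]scalerAr scalerAl scalerAl; congr (_ * _).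
  rewrite !scalerBr scaleNr scalerA mulNr mulfK ?gt_eqF // scaleNr opprK addrC.
  by rewrite -alg_polyC scalerA.
rewrite -(IH (- (a * z))) //; first by move=> y ys; apply: s_gt0; rewrite inE ys orbT.
by move: pz; rewrite !hornerE /= => <-; rewrite mulrN !mulNr.
Qed.

Import Rstruct.

Lemma cont_coef_poly (c : nat -> Rdefinitions.R) (N j k : nat) :
  cont_coef c N j k = (cont_poly c N j)`_k.
Proof.
elim/ltn_ind: N j k => -[|N] IH j k; first by rewrite /= coef1; case: k.
rewrite cont_polyS coefB coefZ coefXM -IH //=.
by case: k => [|k] //=; rewrite (IH N.-1) // ltnS leq_pred.
Qed.

Lemma prod_coef_poly (l : seq Rdefinitions.R) (k : nat) :
  prod_coef l k = (\prod_(x <- l) (1 - x *: 'X))`_k.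
Proof.
elim: l k => [|x l IH] k; first by rewrite big_nil coef1; case: k.
rewrite big_cons mulrBl mul1r coefB -scalerAl coefZ coefXM -IH /=.
by case: k => [|k] //=; rewrite (IH k).
Qed.

Lemma cont_coef_factor (c : nat -> Rdefinitions.R) (N : nat) :
  (forall i, Rlt 0 (c i)) ->
  {l : list Rdefinitions.R | List.Forall (Rlt 0) l &
     forall k, cont_coef c N 0 k = prod_coef l k}.
Proof.
move=> c_gt0; have [i|s s_gt0 sE] := @cont_poly_factor _ c N.
  by apply/RltP/c_gt0.
exists s; last by move=> k; rewrite prod_coef_poly -sE cont_coef_poly.
elim: s s_gt0 {sE} => [|x s IH] /=; first by constructor.
by move=> /andP[/RltP x0 s0]; constructor; [|exact: IH].
Qed.

End Continuant.

(** * Power sums and Cauchy products *)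

Definition psum (l : list R) (k : nat) : R := fold_right (fun x s => x ^ k + s) 0 l.

(** Coefficients of sum x z / (1 - x z), the series - z F' / F of F = prod (1 - x z). It has no
    constant term, whereas [psum l 0] counts the entries. *)
Definition psum_pos (l : list R) (k : nat) : R :=
  match k with O => 0 | S _ => psum l k end.

(** The complete homogeneous symmetric polynomials of the entries, that is, the coefficients of 1 /
    prod (1 - x z). *)
Fixpoint compl_coef (l : list R) : nat -> R :=
  match l with
  | nil => fun k => match k with O => 1 | S _ => 0 end
  | cons x l' =>
      fix g k := match k with
                 | O => compl_coef l' O
                 | S m => compl_coef l' (S m) + x * g m
                 end
  end.

Definition unit_coef (k : nat) : R := match k with O => 1 | S _ => 0 end.

Lemma PS_mult_ext (a a' b b' : nat -> R) (n : nat) :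
  (forall k, a k = a' k) -> (forall k, b k = b' k) -> PS_mult a b n = PS_mult a' b' n.
Proof.
  intros Ha Hb; unfold PS_mult; apply sum_eq; intros i _; now rewrite Ha, Hb.
Qed.

Lemma PS_mult_succ (a b : nat -> R) (n : nat) :
  PS_mult a b (S n) = a O * b (S n) + PS_mult (fun k => a (S k)) b n.
Proof.
  unfold PS_mult; rewrite decomp_sum by lia; simpl pred; f_equal.
Qed.

Lemma PS_mult_plus_l (a a' b : nat -> R) (n : nat) :
  PS_mult (fun k => a k + a' k) b n = PS_mult a b n + PS_mult a' b n.
Proof.
  unfold PS_mult; rewrite <- sum_plus; apply sum_eq; intros; ring.
Qed.

Lemma PS_mult_scal_l (x : R) (a b : nat -> R) (n : nat) :
  PS_mult (fun k => x * a k) b n = x * PS_mult a b n.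
Proof.
  unfold PS_mult; rewrite scal_sum; apply sum_eq; intros; ring.
Qed.

Lemma PS_mult_minus_scal_r (x : R) (a b b' : nat -> R) (n : nat) :
  PS_mult a (fun k => b k - x * b' k) n = PS_mult a b n - x * PS_mult a b' n.
Proof.
  unfold PS_mult; rewrite scal_sum, <- minus_sum; apply sum_eq; intros; ring.
Qed.

Lemma PS_mult_shift_l (a b : nat -> R) (n : nat) :
  PS_mult (shift a) b n = shift (PS_mult a b) n.
Proof.
  destruct n as [|n].
  - unfold PS_mult; simpl; ring.
  - rewrite PS_mult_succ; simpl; rewrite Rmult_0_l, Rplus_0_l; now apply PS_mult_ext.
Qed.

Lemma PS_mult_shift_r (a b : nat -> R) (n : nat) :
  PS_mult a (shift b) n = shift (PS_mult a b) n.
Proof.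
  destruct n as [|n].
  - unfold PS_mult; simpl; ring.
  - unfold PS_mult; rewrite tech5, Nat.sub_diag; simpl (shift b 0).
    rewrite Rmult_0_r, Rplus_0_r; simpl (shift _ (S n)); apply sum_eq; intros i Hi.
    now replace (S n - i)%nat with (S (n - i)) by lia.
Qed.

(** Coefficient form of x z / (1 - x z) times (1 - x z) F = x z F. *)
Lemma PS_mult_geom (x : R) (f : nat -> R) (n : nat) :
  PS_mult (fun k => match k with O => 0 | S _ => x ^ k end)
    (fun k => f k - x * shift f k) n = x * shift f n.
Proof.
  set (g := fun k => match k with O => 0 | S _ => x ^ k end).
  assert (Hg : forall m, PS_mult g f (S m) = x * f m + x * PS_mult g f m).
  { intros m; rewrite PS_mult_succ; simpl (g 0%nat); rewrite Rmult_0_l, Rplus_0_l.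
    rewrite (PS_mult_ext _ (fun k => x * unit_coef k + x * g k) f f) by
      (reflexivity || (intros [|k]; simpl; ring)).
    rewrite PS_mult_plus_l, !PS_mult_scal_l; f_equal; f_equal.
    destruct m as [|m]; [unfold PS_mult; simpl; ring|].
    rewrite PS_mult_succ; simpl.
    unfold PS_mult; rewrite (sum_eq _ (fun _ => 0)) by (intros; ring).
    rewrite sum_cte; ring. }
  rewrite PS_mult_minus_scal_r, PS_mult_shift_r.
  destruct n as [|m]; [unfold PS_mult; simpl; ring|].
  rewrite Hg; simpl; ring.
Qed.

(** Newton's identities, in the form P F = - z F'. Adjoining a factor 1 - x z adds x z / (1 - x z)
    to P, which is the product rule for the logarithmic derivative. *)
Lemma newton_prod_coef (l : list R) (n : nat) :
  PS_mult (psum_pos l) (prod_coef l) n = - INR n * prod_coef l n.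
Proof.
  revert n; induction l as [|x l IH]; intros n.
  - unfold PS_mult; rewrite (sum_eq _ (fun _ => 0)) by
      (intros [|i] _; simpl; ring).
    rewrite sum_cte; destruct n; simpl; ring.
  - simpl prod_coef.
    rewrite (PS_mult_ext _
      (fun k => (match k with O => 0 | S _ => x ^ k end) + psum_pos l k)
      _ (fun k => prod_coef l k - x * shift (prod_coef l) k)) by
      (reflexivity || (intros [|k]; simpl; ring)).
    rewrite PS_mult_plus_l, PS_mult_geom, PS_mult_minus_scal_r, PS_mult_shift_r.
    destruct n as [|n]; simpl shift; rewrite ?IH; [simpl; ring|].
    rewrite S_INR; ring.
Qed.

Lemma compl_coef_cons (x : R) (l : list R) (k : nat) :
  compl_coef (x :: l) k = compl_coef l k + x * shift (compl_coef (x :: l)) k.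
Proof. destruct k; simpl; ring. Qed.

Lemma compl_prod_coef (l : list R) (n : nat) :
  PS_mult (compl_coef l) (prod_coef l) n = unit_coef n.
Proof.
  revert n; induction l as [|x l IH]; intros n.
  - destruct n as [|n]; [unfold PS_mult; simpl; ring|].
    rewrite PS_mult_succ; simpl; unfold PS_mult.
    rewrite (sum_eq _ (fun _ => 0)) by (intros; ring); rewrite sum_cte; ring.
  - rewrite <- IH; simpl prod_coef.
    rewrite PS_mult_minus_scal_r, PS_mult_shift_r.
    rewrite <- PS_mult_shift_l, <- PS_mult_scal_l.
    rewrite (PS_mult_ext _ (fun k => compl_coef l k + x * shift (compl_coef (x :: l)) k)
      (prod_coef l) (prod_coef l)) by (reflexivity || intros; apply compl_coef_cons).
    rewrite PS_mult_plus_l; ring.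
Qed.

Lemma prod_coef_0 (l : list R) : prod_coef l 0 = 1.
Proof. induction l as [|x l IH]; simpl; [|rewrite IH]; ring. Qed.

Lemma psum_ge0 (l : list R) (k : nat) : List.Forall (Rlt 0) l -> 0 <= psum l k.
Proof.
  induction 1 as [|x l Hx _ IH]; simpl; [lra|].
  assert (0 < x ^ k) by (apply pow_lt; lra); lra.
Qed.

(** Each monomial of degree k occurs in the k-th power of the sum of the entries with coefficient at
    least 1. The bound survives the limit and makes the series of 1 / F converge for |z| p_1 < 1. *)
Lemma compl_coef_bound (l : list R) (k : nat) :
  List.Forall (Rlt 0) l -> 0 <= compl_coef l k <= psum l 1 ^ k.
Proof.
  intros Hl; revert k; induction Hl as [|x l Hx Hl IH]; intros k.
  - destruct k as [|k]; simpl; [lra|]; nra.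
  - assert (Hs := psum_ge0 l 1 Hl).
    induction k as [|k IHk]; [apply (IH 0%nat)|].
    rewrite compl_coef_cons; simpl shift.
    assert (H1 := IH (S k)).
    change (psum (x :: l) 1) with (x ^ 1 + psum l 1) in *.
    rewrite pow_1 in *.
    assert (H2 : psum l 1 ^ k <= (x + psum l 1) ^ k) by (apply pow_incr; lra).
    simpl in *; split; nra.
Qed.

(** The quadratic is the sum of x^k (t - x)^2. Log-convexity is kept in this form because it passes
    to limits and leaves [t] free to choose. *)
Lemma psum_quadratic (l : list R) (k : nat) (t : R) :
  List.Forall (Rlt 0) l -> 0 <= psum l k * t ^ 2 - 2 * psum l (S k) * t + psum l (S (S k)).
Proof.
  induction 1 as [|x l Hx _ IH]; simpl in *; [lra|].
  assert (0 <= x ^ k * (t - x) ^ 2).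
  { apply Rmult_le_pos; [apply pow_le; lra | apply pow2_ge_0]. }
  nra.
Qed.

(** Every entry is at most t = sqrt p_2, so x^(k+2) <= t^k x^2; summation gives t^k p_2. *)
Lemma psum_le_sqrt (l : list R) (k : nat) :
  List.Forall (Rlt 0) l -> psum l (S (S k)) <= sqrt (psum l 2) ^ S (S k).
Proof.
  intros Hl; set (t := sqrt (psum l 2)).
  assert (Ht : 0 <= t) by apply sqrt_pos.
  assert (Ht2 : t ^ 2 = psum l 2) by (apply pow2_sqrt, psum_ge0, Hl).
  assert (Hle : List.Forall (fun x => 0 < x <= t) l).
  { assert (Hd : psum l 2 <= t ^ 2) by lra.
    clearbody t; clear Ht2; induction Hl as [|x l Hx Hl IH]; constructor.
    - assert (H := psum_ge0 l 2 Hl); simpl in Hd, H; nra.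
    - apply IH; simpl in *; nra. }
  replace (t ^ S (S k)) with (t ^ k * psum l 2) by (rewrite <- Ht2; simpl; ring).
  clear Hl Ht2; clearbody t; induction Hle as [|x l Hx _ IH]; simpl in *; [lra|].
  assert (Hk : x ^ k <= t ^ k) by (apply pow_incr; lra).
  assert (0 < x * x) by nra; nra.
Qed.

Lemma is_lim_seq_sum_f_R0 (u : nat -> nat -> R) (v : nat -> R) (n : nat) :
  (forall k, (k <= n)%nat -> is_lim_seq (fun N => u N k) (v k)) ->
  is_lim_seq (fun N => sum_f_R0 (u N) n) (sum_f_R0 v n).
Proof.
  induction n as [|n IH]; intros H; simpl; [now apply H|].
  apply (is_lim_seq_plus' _ _ (sum_f_R0 v n) (v (S n))); [apply IH; auto | now apply H].
Qed.

(** With leading coefficient 1 the convolution equation is triangular: b_k is d_k minus products of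
    earlier b_i with coefficients of a. Convergence of a and d therefore passes to b by strong
    induction on k. This serves both the power sums and the reciprocal series. *)
Lemma is_lim_seq_PS_mult_left (a b d : nat -> nat -> R) (A D : nat -> R) :
  (forall N, a N O = 1) -> (forall k, is_lim_seq (fun N => a N k) (A k)) ->
  (forall N k, PS_mult (b N) (a N) k = d N k) ->
  (forall k, is_lim_seq (fun N => d N k) (D k)) ->
  exists B : nat -> R, (forall k, is_lim_seq (fun N => b N k) (B k)) /\
    forall k, PS_mult B A k = D k.
Proof.
  intros Ha HA Hb HD.
  exists (fun k => real (Lim_seq (fun N => b N k))).
  assert (Hlim : forall k, is_lim_seq (fun N => b N k) (real (Lim_seq (fun N => b N k)))).
  { intros k; induction k as [k IH] using (well_founded_induction Wf_nat.lt_wf).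
    assert (Hex : ex_finite_lim_seq (fun N => b N k)).
    { destruct k as [|k].
      - exists (D O); apply is_lim_seq_ext with (2 := HD O); intros N.
        rewrite <- Hb; unfold PS_mult; simpl; rewrite Ha; ring.
      - set (B := fun k => real (Lim_seq (fun N => b N k))).
        exists (D (S k) - sum_f_R0 (fun i => B i * A (S k - i)%nat) k).
        apply is_lim_seq_ext with
          (fun N => d N (S k) - sum_f_R0 (fun i => b N i * a N (S k - i)%nat) k).
        + intros N; rewrite <- Hb; unfold PS_mult.
          change (sum_f_R0 (fun i => b N i * a N (S k - i)%nat) (S k)) with
            (sum_f_R0 (fun i => b N i * a N (S k - i)%nat) k + b N (S k) * a N (S k - S k)%nat).
          rewrite Nat.sub_diag, Ha; ring.
        + apply is_lim_seq_minus'; [apply HD|].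
          apply (is_lim_seq_sum_f_R0 (fun N i => b N i * a N (S k - i)%nat)).
          intros i Hi; apply is_lim_seq_mult'; [apply IH; lia | apply HA]. }
    destruct Hex as [x Hx]; rewrite (is_lim_seq_unique _ _ Hx); exact Hx. }
  split; [exact Hlim|].
  intros k.
  assert (H : is_lim_seq (fun N => PS_mult (b N) (a N) k)
    (PS_mult (fun k => real (Lim_seq (fun N => b N k))) A k)).
  { unfold PS_mult; apply (is_lim_seq_sum_f_R0 (fun N i => b N i * a N (k - i)%nat)).
    intros i _; apply is_lim_seq_mult'; [apply Hlim | apply HA]. }
  apply is_lim_seq_ext with (v := fun N => d N k) in H; [|intros; apply Hb].
  apply is_lim_seq_unique in H; rewrite (is_lim_seq_unique _ _ (HD k)) in H.
  now injection H.
Qed.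

(** * The q-Bessel coefficients *)

(** With Q = q^(nu+1) the exponent n (n + nu) splits as n (n - 1) + n (nu + 1), so only natural
    powers of [q] and [Q] remain. The parameter shift nu -> nu + 1 becomes Q -> Q q. *)
Definition bessel_coef (q Q : R) (n : nat) : R :=
  (-1) ^ n * (q ^ (n * (n - 1)) * Q ^ n) / (4 ^ n * qpoch q q n * qpoch Q q n).

Definition chain_coef (q Q : R) : R := Q / (4 * (1 - Q) * (1 - Q * q)).

Lemma pow_lt_1 (q : R) (n : nat) : 0 < q < 1 -> 0 < q ^ n <= 1.
Proof.
  intros Hq; split; [apply pow_lt; lra|].
  rewrite <- (pow1 n); apply pow_incr; lra.
Qed.

Lemma qpoch_pos (a q : R) (n : nat) : 0 < q < 1 -> 0 < a < 1 -> 0 < qpoch a q n.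
Proof.
  intros Hq Ha; induction n as [|n IH]; simpl; [lra|].
  apply Rmult_lt_0_compat; [exact IH|].
  assert (H := pow_lt_1 q n Hq); nra.
Qed.

Lemma qpoch_succ_l (a q : R) (n : nat) : qpoch a q (S n) = (1 - a) * qpoch (a * q) q n.
Proof.
  induction n as [|n IH]; [simpl; ring|].
  change (qpoch a q (S (S n))) with (qpoch a q (S n) * (1 - a * q ^ S n)).
  rewrite IH; simpl; ring.
Qed.

Lemma bessel_coef_0 (q Q : R) : bessel_coef q Q 0 = 1.
Proof. unfold bessel_coef; simpl; field. Qed.

Lemma bessel_coef_succ (q Q : R) (n : nat) : 0 < q < 1 -> 0 < Q < 1 ->
  bessel_coef q Q (S n) =
  - (q ^ (2 * n) * Q / (4 * (1 - q * q ^ n) * (1 - Q * q ^ n))) * bessel_coef q Q n.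
Proof.
  intros Hq HQ; unfold bessel_coef.
  replace (S n * (S n - 1))%nat with (n * (n - 1) + 2 * n)%nat by (destruct n; simpl; lia).
  rewrite pow_add; simpl qpoch; simpl (_ ^ S n).
  assert (H1 := qpoch_pos q q n Hq Hq); assert (H2 := qpoch_pos Q q n Hq HQ).
  assert (H3 := pow_lt_1 q n Hq); assert (H4 : 0 < 4 ^ n) by (apply pow_lt; lra).
  field; repeat split; nra.
Qed.

Lemma bessel_coef_neq0 (q Q : R) (n : nat) : 0 < q < 1 -> 0 < Q < 1 -> bessel_coef q Q n <> 0.
Proof.
  intros Hq HQ; induction n as [|n IH]; [rewrite bessel_coef_0; lra|].
  rewrite bessel_coef_succ by assumption.
  assert (H3 := pow_lt_1 q n Hq); assert (H4 := pow_lt_1 q (2 * n) Hq).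
  apply Rmult_integral_contrapositive_currified; [|exact IH].
  apply Ropp_neq_0_compat, Rgt_not_eq, Rdiv_lt_0_compat; [nra|].
  repeat apply Rmult_lt_0_compat; nra.
Qed.

Lemma bessel_coef_rec (q Q : R) (n : nat) : 0 < q < 1 -> 0 < Q < 1 ->
  bessel_coef q Q n = bessel_coef q (Q * q) n
    - chain_coef q Q * shift (bessel_coef q (Q * q * q)) n.
Proof.
  intros Hq HQ; destruct n as [|n]; [simpl; rewrite !bessel_coef_0; ring|].
  simpl shift; unfold bessel_coef, chain_coef.
  replace (S n * (S n - 1))%nat with (n * (n - 1) + (n + n))%nat by (destruct n; simpl; lia).
  rewrite !pow_add, (qpoch_succ_l Q).
  assert (HQq : 0 < Q * q < 1) by nra.
  assert (HY := qpoch_succ_l (Q * q) q n).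
  simpl qpoch in *; simpl (_ ^ S n); rewrite !Rpow_mult_distr.
  assert (H1 := qpoch_pos q q n Hq Hq); assert (H2 := qpoch_pos (Q * q) q n Hq HQq).
  assert (H5 : 0 < qpoch (Q * q * q) q n) by (apply qpoch_pos; nra).
  assert (H3 := pow_lt_1 q n Hq); assert (H4 : 0 < 4 ^ n) by (apply pow_lt; lra).
  (* Once all symbols are expressed through (Q q; q)_n, the recursion is an identity of rational
     functions. *)
  assert (HY' : qpoch (Q * q * q) q n = qpoch (Q * q) q n * (1 - Q * q * q ^ n) / (1 - Q * q)).
  { rewrite HY; field; lra. }
  assert (0 < 1 - Q * (q * q ^ n)) by nra.
  rewrite HY'; field; repeat split; nra.
Qed.

(** The numerator keeps Q' while the denominator is uniform in it: for Q' = Q q^j this yields the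
    factor q^j that starts the error estimate for the continuants. *)
Lemma bessel_coef_bound (q Q Q' : R) (n : nat) : 0 < q < 1 -> 0 < Q' <= Q -> Q < 1 ->
  Rabs (bessel_coef q Q' n) <= (Q' / (4 * (1 - q) * (1 - Q))) ^ n.
Proof.
  intros Hq HQ' HQ; induction n as [|n IH].
  - rewrite bessel_coef_0, Rabs_R1; simpl; lra.
  - rewrite bessel_coef_succ, Rabs_mult, Rabs_Ropp by lra.
    assert (H3 := pow_lt_1 q n Hq); assert (H4 := pow_lt_1 q (2 * n) Hq).
    assert (D1 : 0 < (1 - q) * (1 - Q)) by nra.
    assert (D2 : (1 - q) * (1 - Q) <= (1 - q * q ^ n) * (1 - Q' * q ^ n)).
    { apply Rmult_le_compat; nra. }
    rewrite <- tech_pow_Rmult; apply Rmult_le_compat; [apply Rabs_pos | apply Rabs_pos | | exact IH].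
    rewrite Rabs_pos_eq.
    + unfold Rdiv; apply Rmult_le_compat; [nra | | nra | apply Rinv_le_contravar; nra].
      apply Rlt_le, Rinv_0_lt_compat; nra.
    + apply Rlt_le, Rdiv_lt_0_compat; nra.
Qed.

(** * Convergence of the continuants and the limiting Rayleigh sums *)

Section Chain.
Variables q Q : R.
Hypotheses (Hq : 0 < q < 1) (HQ : 0 < Q < 1).

Let c (j : nat) : R := chain_coef q (Q * q ^ j).
Let B : R := / (4 * (1 - q) * (1 - Q)).

Lemma chain_arg_bound (j : nat) : 0 < Q * q ^ j <= Q.
Proof. assert (H := pow_lt_1 q j Hq); nra. Qed.

Lemma chain_coef_pos (j : nat) : 0 < c j.
Proof.
  assert (H := chain_arg_bound j); apply Rdiv_lt_0_compat; [lra|].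
  repeat apply Rmult_lt_0_compat; nra.
Qed.

(** The right side is just B q^j, written as a difference so that sums over [j] telescope. *)
Lemma chain_coef_le (j : nat) : c j <= B / (1 - q) * (q ^ j - q ^ S j).
Proof.
  assert (H := chain_arg_bound j); assert (Hj := pow_lt_1 q j Hq).
  replace (B / (1 - q) * (q ^ j - q ^ S j)) with (q ^ j * / (4 * (1 - q) * (1 - Q)))
    by (unfold B; simpl; field; lra).
  assert (D : (1 - q) * (1 - Q) <= (1 - Q * q ^ j * q) * (1 - Q * q ^ j)).
  { apply Rmult_le_compat; nra. }
  assert (0 < (1 - q) * (1 - Q)) by nra.
  apply Rmult_le_compat; [lra | | nra | apply Rinv_le_contravar; nra].
  apply Rlt_le, Rinv_0_lt_compat; nra.
Qed.

(** The Bessel coefficients and the continuants obey the same recursion, hence so does their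
    difference. The outer induction is on the degree k, which [shift] lowers, and the inner one on
    [N]; uniformity in [j] is essential since the recursion moves to j + 1 and j + 2. *)
Lemma cont_coef_error (k : nat) : exists D : R, 0 <= D /\ forall N j : nat,
  Rabs (bessel_coef q (Q * q ^ j) k - cont_coef c N j k) <= D * q ^ (N + j).
Proof.
  assert (HB : 0 < B) by (apply Rinv_0_lt_compat; repeat apply Rmult_lt_0_compat; lra).
  set (B' := B / (1 - q)).
  assert (HB' : 0 < B') by (apply Rdiv_lt_0_compat; lra).
  assert (step : forall N j k, bessel_coef q (Q * q ^ j) k - cont_coef c (S N) j k =
    (bessel_coef q (Q * q ^ S j) k - cont_coef c N (S j) k)
    - c j * (shift (bessel_coef q (Q * q ^ S (S j))) k - shift (cont_coef c (pred N) (S (S j))) k)).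
  { intros N j m; simpl cont_coef.
    assert (H := chain_arg_bound j).
    rewrite (bessel_coef_rec q (Q * q ^ j)) by lra.
    replace (Q * q ^ j * q) with (Q * q ^ S j) by (simpl; ring).
    replace (Q * q ^ S j * q) with (Q * q ^ S (S j)) by (simpl; ring).
    unfold c; ring. }
  assert (base : forall k j, Rabs (bessel_coef q (Q * q ^ j) k - cont_coef c 0 j k) <= B ^ k * q ^ j).
  { clear k; intros k j; assert (Hj := pow_lt_1 q j Hq).
    destruct k as [|m]; simpl cont_coef.
    - rewrite bessel_coef_0; replace (1 - 1) with 0 by ring; rewrite Rabs_R0; simpl; lra.
    - rewrite Rminus_0_r.
      apply Rle_trans with (1 := bessel_coef_bound q Q (Q * q ^ j) (S m) Hq
        (chain_arg_bound j) (proj2 HQ)).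
      unfold Rdiv; fold B; rewrite Rpow_mult_distr, Rmult_comm.
      apply Rmult_le_compat_l; [apply pow_le; lra|].
      assert (H := chain_arg_bound j).
      assert ((Q * q ^ j) ^ m <= 1) by (rewrite <- (pow1 m); apply pow_incr; lra).
      assert (0 <= (Q * q ^ j) ^ m) by (apply pow_le; lra).
      simpl; nra. }
  assert (HBk : forall k, 0 < B ^ k) by (intros; now apply pow_lt).
  induction k as [|k IH].
  - exists (B ^ 0); split; [apply Rlt_le, HBk|].
    intros N; induction N as [|N IHN]; intros j; [apply base|].
    rewrite step; simpl shift; rewrite Rminus_diag, Rmult_0_r, Rminus_0_r.
    replace (S N + j)%nat with (N + S j)%nat by lia; apply IHN.
  - destruct IH as [D [HD IH]].
    (* The term q^j - q^(N+j) is the telescoped sum of the bounds on the chain coefficients met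
       along the recursion. *)
    assert (main : forall N j,
      Rabs (bessel_coef q (Q * q ^ j) (S k) - cont_coef c N j (S k)) <=
      (B ^ S k + D * B' * (q ^ j - q ^ (N + j))) * q ^ (N + j)).
    { intros N; induction N as [|N IHN]; intros j.
      - simpl (0 + j)%nat; rewrite Rminus_diag, Rmult_0_r, Rplus_0_r; apply base.
      - rewrite step; cbn [shift].
        assert (H1 := IHN (S j)); assert (H2 := IH (pred N) (S (S j))).
        assert (Hc := chain_coef_pos j); assert (Hc' := chain_coef_le j); fold B' in Hc'.
        replace (S N + j)%nat with (N + S j)%nat by lia.
        set (n := (N + S j)%nat) in *.
        (* The exponents agree for [N] > 0; for [N] = 0 the truncated [pred] makes the left one
           larger by one. *)
        assert (Hn : q ^ (pred N + S (S j)) <= q ^ n).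
        { unfold n; destruct N as [|N]; simpl pred.
          - assert (H := pow_lt_1 q (S j) Hq); simpl in *; nra.
          - replace (N + S (S j))%nat with (S N + S j)%nat by lia; lra. }
        assert (Hqn := pow_lt_1 q n Hq).
        apply Rle_trans with (1 := Rabs_triang _ _).
        rewrite Rabs_Ropp, Rabs_mult, (Rabs_pos_eq (c j)) by lra.
        assert (H3 : c j * Rabs (bessel_coef q (Q * q ^ S (S j)) k -
           cont_coef c (pred N) (S (S j)) k) <= B' * (q ^ j - q ^ S j) * (D * q ^ n)).
        { apply Rmult_le_compat; [lra | apply Rabs_pos | lra |].
          apply Rle_trans with (1 := H2); apply Rmult_le_compat_l; lra. }
        lra. }
    exists (B ^ S k + D * B'); split; [assert (H := HBk (S k)); nra|].
    intros N j; apply Rle_trans with (1 := main N j).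
    assert (H1 := pow_lt_1 q j Hq); assert (H2 := pow_lt_1 q (N + j) Hq).
    assert (0 <= D * B') by nra.
    apply Rmult_le_compat_r; [lra|]; nra.
Qed.

Lemma cont_coef_lim (k : nat) : is_lim_seq (fun N => cont_coef c N 0 k) (bessel_coef q Q k).
Proof.
  destruct (cont_coef_error k) as [D [HD H]].
  apply is_lim_seq_ext with
    (fun N => bessel_coef q Q k - (bessel_coef q Q k - cont_coef c N 0 k)); [intros; ring|].
  replace (Finite (bessel_coef q Q k)) with (Finite (bessel_coef q Q k - 0)) by (f_equal; ring).
  apply is_lim_seq_minus'; [apply is_lim_seq_const|].
  apply is_lim_seq_abs_0, is_lim_seq_le_le with (u := fun _ => 0) (w := fun N => D * q ^ N).
  - intros N; split; [apply Rabs_pos|].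
    assert (HN := H N 0%nat); rewrite Nat.add_0_r, pow_O, Rmult_1_r in HN; exact HN.
  - apply is_lim_seq_const.
  - replace (Finite 0) with (Finite (D * 0)) by (f_equal; ring).
    apply (is_lim_seq_scal_l _ D (Finite 0)), is_lim_seq_geom; rewrite Rabs_pos_eq; lra.
Qed.

(** For each continuant the Newton sums and the complete symmetric polynomials of its reciprocal
    zeros satisfy all the listed relations. Every relation involves finitely many coefficients and
    is closed, so it holds for the limits [p] and [g], the coefficients of - z F' / F and 1 / F. *)
Lemma bessel_rayleigh : exists p g : nat -> R,
  p O = 0 /\
  (forall k, PS_mult p (bessel_coef q Q) k = - INR k * bessel_coef q Q k) /\
  (forall k, PS_mult g (bessel_coef q Q) k = unit_coef k) /\
  (forall k, 0 <= g k <= p 1%nat ^ k) /\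
  (forall k, 0 <= p k) /\
  (forall k, p (S (S k)) <= sqrt (p 2%nat) ^ S (S k)) /\
  (forall k t, 0 <= p (S k) * t ^ 2 - 2 * p (S (S k)) * t + p (S (S (S k)))).
Proof.
  set (xs := fun N => let (l, _, _) := @Continuant.cont_coef_factor c N chain_coef_pos in l).
  assert (Hpos : forall N, List.Forall (Rlt 0) (xs N)).
  { intros N; unfold xs; now destruct (@Continuant.cont_coef_factor c N chain_coef_pos). }
  assert (Hcoef : forall N k, cont_coef c N 0 k = prod_coef (xs N) k).
  { intros N; unfold xs; now destruct (@Continuant.cont_coef_factor c N chain_coef_pos). }
  assert (Hlim : forall k, is_lim_seq (fun N => prod_coef (xs N) k) (bessel_coef q Q k)).
  { intros k; apply is_lim_seq_ext with (2 := cont_coef_lim k); intros N; apply Hcoef. }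
  destruct (is_lim_seq_PS_mult_left (fun N => prod_coef (xs N)) (fun N => psum_pos (xs N))
    (fun N k => - INR k * prod_coef (xs N) k) (bessel_coef q Q)
    (fun k => - INR k * bessel_coef q Q k)) as [p [Hp HpP]].
  { intros N; apply prod_coef_0. }
  { exact Hlim. }
  { intros N k; apply newton_prod_coef. }
  { intros k; apply (is_lim_seq_scal_l _ (- INR k) (bessel_coef q Q k)), Hlim. }
  destruct (is_lim_seq_PS_mult_left (fun N => prod_coef (xs N)) (fun N => compl_coef (xs N))
    (fun N k => unit_coef k) (bessel_coef q Q) unit_coef) as [g [Hg HgP]].
  { intros N; apply prod_coef_0. }
  { exact Hlim. }
  { intros N k; apply compl_prod_coef. }
  { intros k; apply is_lim_seq_const. }
  exists p, g; repeat split; try assumption.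
  - assert (H := is_lim_seq_unique _ _ (Hp 0%nat)); simpl in H.
    rewrite Lim_seq_const in H; now injection H.
  - refine (is_lim_seq_le (fun _ => 0) (fun N => compl_coef (xs N) k) 0 (g k) _ _ (Hg k)).
    + intros N; now apply compl_coef_bound.
    + apply is_lim_seq_const.
  - refine (is_lim_seq_le (fun N => compl_coef (xs N) k) (fun N => psum_pos (xs N) 1 ^ k)
      (g k) (p 1%nat ^ k) _ (Hg k) _).
    + intros N; now apply compl_coef_bound.
    + apply (is_lim_seq_continuous (fun x => x ^ k)), Hp.
      apply derivable_continuous_pt, derivable_pt_pow.
  - intros k.
    refine (is_lim_seq_le (fun _ => 0) (fun N => psum_pos (xs N) k) 0 (p k) _ _ (Hp k)).
    + intros N; destruct k; [simpl; lra | now apply psum_ge0].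
    + apply is_lim_seq_const.
  - intros k.
    refine (is_lim_seq_le (fun N => psum_pos (xs N) (S (S k)))
      (fun N => sqrt (psum_pos (xs N) 2) ^ S (S k)) _ (sqrt (p 2%nat) ^ S (S k)) _ (Hp _) _).
    + intros N; now apply psum_le_sqrt.
    + apply (is_lim_seq_continuous (fun x => x ^ S (S k)));
        [apply derivable_continuous_pt, derivable_pt_pow|].
      apply (is_lim_seq_continuous sqrt); [|apply Hp].
      apply continuity_pt_sqrt.
      refine (is_lim_seq_le (fun _ => 0) (fun N => psum_pos (xs N) 2) 0 (p 2%nat) _ _ (Hp _)).
      * intros N; now apply psum_ge0.
      * apply is_lim_seq_const.
  - intros k t.
    refine (is_lim_seq_le (fun _ => 0) (fun N => psum_pos (xs N) (S k) * t ^ 2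
      - 2 * psum_pos (xs N) (S (S k)) * t + psum_pos (xs N) (S (S (S k)))) 0
      (p (S k) * t ^ 2 - 2 * p (S (S k)) * t + p (S (S (S k)))) _ _ _).
    + intros N; now apply psum_quadratic.
    + apply is_lim_seq_const.
    + apply is_lim_seq_plus'; [apply is_lim_seq_minus'|]; [| |apply Hp].
      * apply (is_lim_seq_scal_r _ (t ^ 2) (p (S k))), Hp.
      * apply (is_lim_seq_scal_r _ t (2 * p (S (S k)))).
        apply (is_lim_seq_scal_l _ 2 (p (S (S k)))), Hp.
Qed.
End Chain.

(** * Euler-Rayleigh bounds *)

Lemma CV_radius_gt_geom (a : nat -> R) (M t x : R) :
  0 < t -> (forall n, Rabs (a n) <= M * t ^ n) -> Rabs x * t < 1 ->
  Rbar_lt (Rabs x) (CV_radius a).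
Proof.
  intros Ht Ha Hx.
  apply Rbar_lt_le_trans with (y := Finite (/ t)).
  - apply (Rmult_lt_reg_r t); [exact Ht|]; rewrite Rinv_l; lra.
  - apply (proj1 (CV_radius_bounded a)); exists M; intros n.
    assert (Hn : 0 < t ^ n) by now apply pow_lt.
    rewrite Rabs_mult, (Rabs_pos_eq ((/ t) ^ n)) by
      (apply pow_le, Rlt_le, Rinv_0_lt_compat, Ht).
    rewrite pow_inv; apply (Rmult_le_reg_r (t ^ n)); [exact Hn|].
    rewrite Rmult_assoc, Rinv_l, Rmult_1_r by lra; apply Ha.
Qed.

(** * Estimates of P and of its root from the properties of the Rayleigh sums alone *)

Section RealBounds.
Variable p : nat -> R.
Hypotheses (p_0 : p O = 0) (p_ge0 : forall k, 0 <= p k)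
  (p_sqrt : forall k, p (S (S k)) <= sqrt (p 2%nat) ^ S (S k))
  (p_quad : forall k t, 0 <= p (S k) * t ^ 2 - 2 * p (S (S k)) * t + p (S (S (S k))))
  (p1_gt0 : 0 < p 1%nat) (p2_gt0 : 0 < p 2%nat) (p2_lt : p 2%nat < p 1%nat ^ 2).

Let t : R := sqrt (p 2%nat).

Lemma sqrt_p2_bounds : 0 < t < p 1%nat /\ t ^ 2 = p 2%nat.
Proof.
  assert (H0 : 0 < t) by now apply sqrt_lt_R0.
  assert (H2 : t ^ 2 = p 2%nat) by (apply pow2_sqrt; lra).
  split; [|exact H2]; split; [exact H0|]; nra.
Qed.

Lemma rayleigh_CV (x : R) : Rabs x * p 1%nat <= 1 -> Rbar_lt (Rabs x) (CV_radius p).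
Proof.
  intros Hx; destruct sqrt_p2_bounds as [[Ht Htp] Ht2].
  assert (Hx0 := Rabs_pos x).
  (* This constant makes the bound an equality at index 1; being at least 1, it also covers all
     higher indices. *)
  apply CV_radius_gt_geom with (M := p 1%nat / t) (t := t); [exact Ht | | nra].
  assert (HM : 1 <= p 1%nat / t).
  { apply (Rmult_le_reg_r t); [exact Ht|]; field_simplify; lra. }
  intros [|[|k]].
  - rewrite p_0, Rabs_R0; simpl; lra.
  - rewrite Rabs_pos_eq by apply p_ge0; simpl; right; field; lra.
  - rewrite Rabs_pos_eq by apply p_ge0.
    apply Rle_trans with (1 := p_sqrt k); fold t.
    assert (0 < t ^ S (S k)) by now apply pow_lt.
    nra.
Qed.

Lemma rayleigh_ex_series (x : R) : 0 <= x -> x * p 1%nat <= 1 ->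
  ex_series (fun k => p k * x ^ k).
Proof.
  intros Hx0 Hx; apply ex_series_Rabs, CV_disk_inside, rayleigh_CV.
  rewrite Rabs_pos_eq; lra.
Qed.

Lemma rayleigh_split (x : R) : 0 <= x -> x * p 1%nat <= 1 ->
  PSeries p x = p 1%nat * x + Series (fun k => p (S (S k)) * x ^ S (S k)).
Proof.
  intros Hx0 Hx; assert (H := rayleigh_ex_series x Hx0 Hx).
  unfold PSeries; rewrite Series_incr_1 by exact H.
  rewrite Series_incr_1 by now apply (ex_series_incr_1 (fun k => p k * x ^ k)).
  rewrite p_0; simpl; ring.
Qed.

Lemma rayleigh_ex_series_tail (x : R) : 0 <= x -> x * p 1%nat <= 1 ->
  ex_series (fun k => p (S (S k)) * x ^ S (S k)).
Proof.
  intros Hx0 Hx; apply (ex_series_incr_n (fun k => p k * x ^ k) 2).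
  now apply rayleigh_ex_series.
Qed.

Lemma rayleigh_lt (x y : R) : 0 <= x < y -> y * p 1%nat <= 1 -> PSeries p x < PSeries p y.
Proof.
  intros Hxy Hy; rewrite !rayleigh_split by nra.
  apply Rplus_lt_le_compat; [nra|].
  apply Series_le; [|apply rayleigh_ex_series_tail; lra].
  intros k; split; [apply Rmult_le_pos; [apply p_ge0 | apply pow_le; lra]|].
  apply Rmult_le_compat_l; [apply p_ge0 | apply pow_incr; lra].
Qed.

Lemma rayleigh_upper (x : R) : 0 <= x -> x * p 1%nat <= 1 ->
  PSeries p x <= p 1%nat * x + (t * x) ^ 2 / (1 - t * x).
Proof.
  intros Hx0 Hx; destruct sqrt_p2_bounds as [[Ht Htp] Ht2].
  assert (Hy : Rabs (t * x) < 1) by (rewrite Rabs_pos_eq; nra).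
  rewrite rayleigh_split by assumption; apply Rplus_le_compat_l.
  unfold Rdiv; rewrite <- Series_geom, <- Series_scal_l by exact Hy.
  apply Series_le; [|exact (ex_series_scal_l ((t * x) ^ 2) (fun k => (t * x) ^ k) (ex_series_geom _ Hy))].
  intros k; assert (H := pow_le x (S (S k)) Hx0).
  split; [apply Rmult_le_pos; [apply p_ge0 | exact H]|].
  replace ((t * x) ^ 2 * (t * x) ^ k) with (t ^ S (S k) * x ^ S (S k))
    by (rewrite !Rpow_mult_distr; simpl; ring).
  apply Rmult_le_compat_r; [exact H | apply p_sqrt].
Qed.

Let rho : R := p 3%nat / p 2%nat.

Lemma rho_bounds : 0 < rho <= t /\ p 2%nat ^ 2 <= p 1%nat * p 3%nat.
Proof.
  destruct sqrt_p2_bounds as [[Ht Htp] Ht2].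
  (* The minimizer of the quadratic; nonnegativity there is the Cauchy-Schwarz inequality p_2^2 <=
     p_1 p_3. *)
  assert (H1 := p_quad 0 (p 2%nat / p 1%nat)).
  assert (H3 : p 2%nat ^ 2 <= p 1%nat * p 3%nat).
  { replace (_ + _) with (p 3%nat - p 2%nat ^ 2 / p 1%nat) in H1 by (field; lra).
    replace (p 2%nat ^ 2) with (p 1%nat * (p 2%nat ^ 2 / p 1%nat)) by (field; lra).
    apply Rmult_le_compat_l; lra. }
  assert (H2 := p_sqrt 1); fold t in H2.
  split; [|exact H3]; split.
  - apply Rdiv_lt_0_compat; [nra | exact p2_gt0].
  - apply (Rmult_le_reg_r (p 2%nat)); [exact p2_gt0|].
    unfold rho; field_simplify; [|lra].
    rewrite <- Ht2; simpl in *; lra.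
Qed.

(** By log-convexity the ratios of consecutive Rayleigh sums do not fall below the ratio [rho] = p_3
    / p_2. The quadratic at t = rho gives p_(k+2) >= 2 rho p_(k+1) - rho^2 p_k, and rho p_k <=
    p_(k+1) then propagates. *)
Lemma rayleigh_ratio (k : nat) : p 2%nat * rho ^ k <= p (S (S k)).
Proof.
  destruct rho_bounds as [[H0 _] _].
  assert (H : forall k, rho * p (S (S k)) <= p (S (S (S k)))).
  { intros n; induction n as [|n IH].
    - right; unfold rho; field; lra.
    - assert (Hq := p_quad (S n) rho); nra. }
  induction k as [|k IH]; simpl; [lra|].
  assert (Hk := H k); nra.
Qed.

Lemma rayleigh_lower (x : R) : 0 <= x -> x * p 1%nat <= 1 ->
  p 1%nat * x + p 2%nat * x ^ 2 / (1 - rho * x) <= PSeries p x.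
Proof.
  intros Hx0 Hx; destruct sqrt_p2_bounds as [[Ht Htp] Ht2].
  destruct rho_bounds as [[H0 Hrt] _].
  assert (Hy : Rabs (rho * x) < 1) by (rewrite Rabs_pos_eq; nra).
  rewrite (rayleigh_split x) by assumption; apply Rplus_le_compat_l.
  unfold Rdiv; rewrite <- Series_geom, <- Series_scal_l by exact Hy.
  apply Series_le; [|now apply rayleigh_ex_series_tail].
  intros k; assert (H := pow_le x (S (S k)) Hx0); assert (Hr := pow_lt rho k H0).
  replace (p 2%nat * x ^ 2 * (rho * x) ^ k) with (p 2%nat * rho ^ k * x ^ S (S k))
    by (rewrite !Rpow_mult_distr; simpl; ring).
  split; [apply Rmult_le_pos; [nra | exact H]|].
  apply Rmult_le_compat_r; [exact H | apply rayleigh_ratio].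
Qed.

(** P is increasing with P(0) = 0 and P(1 / p_1) > 1, so there is a root, and a candidate bound is
    compared with it by testing P at the candidate. Only the second pair of bounds is tested; the
    first pair is weaker and follows from it. *)
Lemma rayleigh_radius : exists r : R,
  0 < r /\ r * p 1%nat < 1 /\ PSeries p r = 1 /\
  (forall x, 0 <= x < r -> PSeries p x < 1) /\
  / (2 * p 1%nat) < r /\
  r < 2 * p 1%nat / (p 1%nat ^ 2 + 3 * p 2%nat) /\
  sqrt (/ (p 1%nat ^ 2 + 3 * p 2%nat)) < r /\
  r < (p 1%nat ^ 2 + 3 * p 2%nat) / (4 * p 3%nat + 3 * p 1%nat * p 2%nat + p 1%nat ^ 3).
Proof.
  destruct sqrt_p2_bounds as [[Ht Htp] Ht2]; destruct rho_bounds as [[H0 Hrt] H13].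
  assert (Hp1 : / p 1%nat * p 1%nat <= 1) by (rewrite Rinv_l; lra).
  assert (Hip : 0 < / p 1%nat) by now apply Rinv_0_lt_compat.
  assert (Hlow1 : 1 < PSeries p (/ p 1%nat)).
  { apply Rlt_le_trans with (2 := rayleigh_lower _ (Rlt_le _ _ Hip) Hp1).
    rewrite Rinv_r by lra.
    assert (0 < p 2%nat * (/ p 1%nat) ^ 2 / (1 - rho * / p 1%nat)); [|lra].
    apply Rdiv_lt_0_compat; [apply Rmult_lt_0_compat; [lra | now apply pow_lt]|].
    assert (rho * / p 1%nat < p 1%nat * / p 1%nat) by (apply Rmult_lt_compat_r; lra).
    rewrite Rinv_r in H; lra. }
  assert (Hzero : PSeries p 0 = 0) by (rewrite PSeries_0; exact p_0).
  destruct (IVT_interv (fun x => PSeries p x - 1) 0 (/ p 1%nat)) as [r [Hr Hr1]].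
  { intros a Ha; apply continuity_pt_minus;
      [|apply continuity_pt_const; intros ? ?; reflexivity].
    apply PSeries_continuity, rayleigh_CV; rewrite Rabs_pos_eq by lra.
    apply Rle_trans with (2 := Hp1), Rmult_le_compat_r; lra. }
  { exact Hip. }
  { rewrite Hzero; lra. }
  { lra. }
  assert (Hr2 : PSeries p r = 1) by lra.
  assert (Hr3 : 0 < r) by (destruct (Req_dec r 0) as [->|]; lra).
  assert (Hr4 : r < / p 1%nat) by (destruct (Req_dec r (/ p 1%nat)) as [->|]; lra).
  assert (Hr5 : r * p 1%nat < 1).
  { rewrite <- (Rinv_l (p 1%nat)) by lra; apply Rmult_lt_compat_r; lra. }
  assert (below : forall z, 0 <= z -> z * p 1%nat <= 1 -> PSeries p z < 1 -> z < r).
  { intros z Hz Hz1 Hz2; apply Rnot_le_lt; intros [Hc | <-]; [|lra].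
    assert (H := rayleigh_lt r z (conj (Rlt_le _ _ Hr3) Hc) Hz1); lra. }
  assert (above : forall z, 0 <= z -> 1 < PSeries p z -> r < z).
  { intros z Hz Hz2; apply Rnot_le_lt; intros [Hc | ->]; [|lra].
    assert (H := rayleigh_lt z r (conj Hz Hc) (Rlt_le _ _ Hr5)); lra. }
  exists r; repeat (split; [assumption|]).
  set (A := p 1%nat ^ 2 + 3 * p 2%nat) in *.
  set (D := 4 * p 3%nat + 3 * p 1%nat * p 2%nat + p 1%nat ^ 3).
  assert (HA : 0 < A) by (unfold A; nra).
  assert (Hp3 : p 3%nat = rho * p 2%nat) by (unfold rho; field; lra).
  assert (HD : D = p 1%nat * A + 4 * (rho * p 2%nat)) by (unfold D, A; rewrite Hp3; ring).
  assert (Hrp : 0 < rho * p 2%nat) by nra.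
  assert (HDpos : 0 < D) by nra.
  assert (L2 : sqrt (/ A) < r).
  { set (z := sqrt (/ A)).
    assert (Hz : 0 < z) by (apply sqrt_lt_R0, Rinv_0_lt_compat, HA).
    assert (Hz2 : z ^ 2 * A = 1).
    { unfold z; rewrite pow2_sqrt by (apply Rlt_le, Rinv_0_lt_compat, HA).
      field; lra. }
    (* In these variables z^2 A = 1 reads a^2 + 3 y^2 = 1, and [rayleigh_upper] reduces P(z) < 1 to
       a + y^2 / (1 - y) < 1. From y < a follows 4 y^2 < 1. *)
    set (a := p 1%nat * z); set (y := t * z).
    assert (Hay : a ^ 2 + 3 * y ^ 2 = 1).
    { unfold a, y; rewrite <- Hz2; unfold A; rewrite <- Ht2; ring. }
    assert (Hy0 : 0 < y) by (unfold y; nra).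
    assert (Hya : y < a) by (unfold y, a; nra).
    assert (Hy2 : y < / 2) by nra.
    assert (Ha1 : a <= 1) by nra.
    apply below; [lra | unfold a in Ha1; lra|].
    apply Rle_lt_trans with (1 := rayleigh_upper z (Rlt_le _ _ Hz) ltac:(unfold a in Ha1; lra)).
    fold a y.
    apply (Rmult_lt_reg_r (1 - y)); [lra|].
    replace ((a + y ^ 2 / (1 - y)) * (1 - y)) with (a * (1 - y) + y ^ 2) by (field; lra).
    (* [(1 - y - y^2)^2 - (a (1 - y))^2 = (y (1 - 2 y))^2] *)
    assert (Hsq : (a * (1 - y)) ^ 2 < (1 - y - y ^ 2) ^ 2).
    { replace ((a * (1 - y)) ^ 2) with ((1 - 3 * y ^ 2) * (1 - y) ^ 2) by
        (rewrite <- Hay; ring).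
      assert (0 < (y * (1 - 2 * y)) ^ 2) by (apply pow_lt, Rmult_lt_0_compat; lra).
      nra. }
    assert (0 < 1 - y - y ^ 2) by nra.
    nra. }
  assert (U2 : r < A / D).
  { assert (Hz : 0 < A / D) by now apply Rdiv_lt_0_compat.
    assert (Hz1 : A / D * p 1%nat < 1).
    { apply (Rmult_lt_reg_r D); [exact HDpos|]; field_simplify; lra. }
    apply above; [lra|].
    apply Rlt_le_trans with (2 := rayleigh_lower _ (Rlt_le _ _ Hz) (Rlt_le _ _ Hz1)).
    assert (Hrz : 0 < D - rho * A) by nra.
    (* Up to positive factors this is the excess over 1 of the lower bound for P at A / D. It is a
       difference of squares, and since rho <= t < p_1 the smaller factor is at least A - 2 t (p_1 +
       t) = (p_1 - t)^2 > 0. *)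
    assert (Hmain : 0 < A ^ 2 - 4 * rho * (D - rho * A)).
    { rewrite HD.
      replace (_ - _) with ((A - 2 * rho * p 1%nat) ^ 2 - (2 * rho * t) ^ 2)
        by (rewrite Rpow_mult_distr, Ht2; unfold A; ring).
      assert (0 < A - 2 * rho * p 1%nat - 2 * rho * t) by (unfold A; rewrite <- Ht2; nra).
      assert (0 < rho * t) by nra.
      nra. }
    replace (p 1%nat * (A / D) + p 2%nat * (A / D) ^ 2 / (1 - rho * (A / D))) with
      (1 + p 2%nat * (A ^ 2 - 4 * rho * (D - rho * A)) / (D * (D - rho * A)))
      by (rewrite HD; rewrite HD in Hrz, HDpos; field; repeat split; nra).
    assert (0 < p 2%nat * (A ^ 2 - 4 * rho * (D - rho * A)) / (D * (D - rho * A))); [|lra].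
    apply Rdiv_lt_0_compat; apply Rmult_lt_0_compat; assumption. }
  split; [|split; [|split; [|split; [exact L2 | exact U2]]]].
  - intros x Hx; rewrite <- Hr2; apply rayleigh_lt; lra.
  - apply Rlt_trans with (2 := L2).
    rewrite <- (sqrt_pow2 (/ (2 * p 1%nat))) by (apply Rlt_le, Rinv_0_lt_compat; lra).
    rewrite pow_inv; apply sqrt_lt_1_alt; split.
    + apply Rlt_le, Rinv_0_lt_compat, pow_lt; lra.
    + apply Rinv_lt_contravar; [apply Rmult_lt_0_compat; [exact HA | apply pow_lt; lra]|].
      unfold A; nra.
  - apply Rlt_trans with (1 := U2).
    apply (Rmult_lt_reg_r (D * A)); [nra|].
    replace (A / D * (D * A)) with (A ^ 2) by (field; lra).
    replace (2 * p 1%nat / A * (D * A)) with (2 * p 1%nat * D) by (field; lra).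
    (* Here 2 p_1 D - A^2 = p_1^4 + 8 p_1 p_3 - 9 p_2^2, which is at least p_1^4 - p_2^2 by p_2^2 <=
       p_1 p_3. *)
    assert (Hlast : 0 < p 1%nat ^ 4 - p 2%nat ^ 2) by nra.
    unfold A, D; nra.
Qed.
End RealBounds.

(** * Complex power series with real coefficients *)

Definition Csummable (U : nat -> C) : Prop := ex_series (fun n => Cmod (U n)).

Lemma im_le_Cmod (z : C) : Rabs (Im z) <= Cmod z.
Proof. apply Rle_trans with (2 := Rmax_Cmod z), Rmax_r. Qed.

Lemma Re_Cmult (x y : C) : Re (Cmult x y) = Re x * Re y - Im x * Im y.
Proof. reflexivity. Qed.

Lemma Im_Cmult (x y : C) : Im (Cmult x y) = Re x * Im y + Im x * Re y.
Proof. reflexivity. Qed.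

Lemma Re_scal (a : R) (z : C) : Re (Cmult (RtoC a) z) = a * Re z.
Proof. rewrite Re_Cmult; simpl; ring. Qed.

Lemma Im_scal (a : R) (z : C) : Im (Cmult (RtoC a) z) = a * Im z.
Proof. rewrite Im_Cmult; simpl; ring. Qed.

Lemma Csummable_le (U : nat -> C) (b : nat -> R) :
  (forall n, Cmod (U n) <= b n) -> ex_series b -> Csummable U.
Proof.
  intros H; apply (@ex_series_le R_AbsRing R_CompleteNormedModule).
  intros n; change (Rabs (Cmod (U n)) <= b n); rewrite Rabs_pos_eq; [apply H | apply Cmod_ge_0].
Qed.

Lemma Csummable_Re_abs (U : nat -> C) : Csummable U -> ex_series (fun n => Rabs (Re (U n))).
Proof.
  apply (@ex_series_le R_AbsRing R_CompleteNormedModule); intros n.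
  change (Rabs (Rabs (Re (U n))) <= Cmod (U n)); rewrite Rabs_Rabsolu; apply re_le_Cmod.
Qed.

Lemma Csummable_Im_abs (U : nat -> C) : Csummable U -> ex_series (fun n => Rabs (Im (U n))).
Proof.
  apply (@ex_series_le R_AbsRing R_CompleteNormedModule); intros n.
  change (Rabs (Rabs (Im (U n))) <= Cmod (U n)); rewrite Rabs_Rabsolu; apply im_le_Cmod.
Qed.

Lemma Csummable_Re (U : nat -> C) : Csummable U -> ex_series (fun n => Re (U n)).
Proof. intros H; now apply ex_series_Rabs, Csummable_Re_abs. Qed.

Lemma Csummable_Im (U : nat -> C) : Csummable U -> ex_series (fun n => Im (U n)).
Proof. intros H; now apply ex_series_Rabs, Csummable_Im_abs. Qed.

Lemma CSeries_ext (U V : nat -> C) : (forall n, U n = V n) -> CSeries U = CSeries V.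
Proof. intros H; unfold CSeries; f_equal; apply Series_ext; intros n; now rewrite H. Qed.

Lemma CSeries_minus (U V : nat -> C) : Csummable U -> Csummable V ->
  CSeries (fun n => Cminus (U n) (V n)) = Cminus (CSeries U) (CSeries V).
Proof.
  intros HU HV; unfold CSeries, Cminus, Cplus, Copp; simpl; f_equal.
  - exact (Series_minus _ _ (Csummable_Re U HU) (Csummable_Re V HV)).
  - exact (Series_minus _ _ (Csummable_Im U HU) (Csummable_Im V HV)).
Qed.

Lemma CSeries_scal (c : C) (U : nat -> C) : Csummable U ->
  CSeries (fun n => Cmult c (U n)) = Cmult c (CSeries U).
Proof.
  intros HU; unfold CSeries, Cmult; simpl; f_equal.
  - rewrite <- !Series_scal_l, <- Series_minus; [reflexivity | |].
    + exact (ex_series_scal_l (fst c) (fun n => Re (U n)) (Csummable_Re U HU)).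
    + exact (ex_series_scal_l (snd c) (fun n => Im (U n)) (Csummable_Im U HU)).
  - rewrite <- !Series_scal_l, <- Series_plus; [reflexivity | |].
    + exact (ex_series_scal_l (fst c) (fun n => Im (U n)) (Csummable_Im U HU)).
    + exact (ex_series_scal_l (snd c) (fun n => Re (U n)) (Csummable_Re U HU)).
Qed.

Lemma Rabs_Re_CSeries (U : nat -> C) : Csummable U ->
  Rabs (Re (CSeries U)) <= Series (fun n => Cmod (U n)).
Proof.
  intros HU; apply Rle_trans with (1 := Series_Rabs _ (Csummable_Re_abs U HU)).
  apply Series_le; [|exact HU]; intros n; split; [apply Rabs_pos | apply re_le_Cmod].
Qed.

Lemma Rabs_Im_CSeries (U : nat -> C) : Csummable U ->
  Rabs (Im (CSeries U)) <= Series (fun n => Cmod (U n)).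
Proof.
  intros HU; apply Rle_trans with (1 := Series_Rabs _ (Csummable_Im_abs U HU)).
  apply Series_le; [|exact HU]; intros n; split; [apply Rabs_pos | apply im_le_Cmod].
Qed.

(** The two components are bounded separately, which costs a factor sqrt 2, rounded up to 2. The
    constant is harmless in the derivative estimate. *)
Lemma Cmod_CSeries (U : nat -> C) : Csummable U ->
  Cmod (CSeries U) <= 2 * Series (fun n => Cmod (U n)).
Proof.
  intros HU; apply Rle_trans with (1 := Cmod_2Rmax _).
  assert (H1 := Rabs_Re_CSeries U HU); assert (H2 := Rabs_Im_CSeries U HU).
  assert (H0 := Rabs_pos (Re (CSeries U))).
  assert (Hm : Rmax (Rabs (Re (CSeries U))) (Rabs (Im (CSeries U))) <=
    Series (fun n => Cmod (U n))) by now apply Rmax_lub.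
  assert (Hs : sqrt 2 <= 2).
  { rewrite <- (sqrt_square 2) at 2 by lra; apply sqrt_le_1_alt; lra. }
  apply Rmult_le_compat; [apply sqrt_pos | | exact Hs | exact Hm].
  apply Rle_trans with (1 := H0), Rmax_l.
Qed.

Definition CPSeries (a : nat -> R) (z : C) : C :=
  CSeries (fun n => Cmult (RtoC (a n)) (Cpow z n)).

Definition abs_cv (a : nat -> R) (r : R) : Prop := ex_series (fun n => Rabs (a n) * r ^ n).

Lemma Cmod_scal_pow (a : R) (z : C) (n : nat) :
  Cmod (Cmult (RtoC a) (Cpow z n)) = Rabs a * Cmod z ^ n.
Proof. now rewrite Cmod_mult, Cmod_R, Cmod_pow. Qed.

Lemma Csummable_CPSeries (a : nat -> R) (z : C) : abs_cv a (Cmod z) ->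
  Csummable (fun n => Cmult (RtoC (a n)) (Cpow z n)).
Proof. apply ex_series_ext; intros n; now rewrite Cmod_scal_pow. Qed.

Lemma abs_cv_CV_radius (a : nat -> R) (r : R) : 0 <= r ->
  Rbar_lt (Rabs r) (CV_radius a) -> abs_cv a r.
Proof.
  intros Hr H; apply ex_series_ext with (2 := CV_disk_inside a r H); intros n.
  rewrite Rabs_mult, (Rabs_pos_eq (r ^ n)); [reflexivity | now apply pow_le].
Qed.

(** [CSeries] sums real and imaginary parts separately, so the complex Cauchy product is assembled
    from four absolutely convergent real ones. *)
Lemma CPSeries_mult (a b : nat -> R) (z : C) :
  abs_cv a (Cmod z) -> abs_cv b (Cmod z) ->
  CPSeries (PS_mult a b) z = Cmult (CPSeries a z) (CPSeries b z).
Proof.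
  intros Ha Hb; apply Csummable_CPSeries in Ha; apply Csummable_CPSeries in Hb.
  set (U := fun n => Cmult (RtoC (a n)) (Cpow z n)) in *.
  set (V := fun n => Cmult (RtoC (b n)) (Cpow z n)) in *.
  assert (cauchy : forall u v : nat -> R, ex_series (fun n => Rabs (u n)) ->
    ex_series (fun n => Rabs (v n)) -> is_series (PS_mult u v) (Series u * Series v)).
  { intros u v Hu Hv; apply is_series_mult; [| |exact Hu | exact Hv];
      now apply Series_correct, ex_series_Rabs. }
  assert (HRa := Csummable_Re_abs U Ha); assert (HIa := Csummable_Im_abs U Ha).
  assert (HRb := Csummable_Re_abs V Hb); assert (HIb := Csummable_Im_abs V Hb).
  assert (term : forall n k, (k <= n)%nat ->
    Cmult (RtoC (a k * b (n - k)%nat)) (Cpow z n) = Cmult (U k) (V (n - k)%nat)).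
  { intros n k Hk; unfold U, V; replace n with (k + (n - k))%nat at 2 by lia.
    rewrite Cpow_add_r, RtoC_mult; ring. }
  unfold CPSeries, CSeries, Cmult at 3; simpl fst; simpl snd; fold U V.
  f_equal.
  - apply is_series_unique.
    apply is_series_ext with (2 := is_series_minus _ _ _ _ (cauchy _ _ HRa HRb) (cauchy _ _ HIa HIb)).
    intros n; change (PS_mult (fun n0 => Re (U n0)) (fun n0 => Re (V n0)) n -
      PS_mult (fun n0 => Im (U n0)) (fun n0 => Im (V n0)) n = Re (Cmult (RtoC (PS_mult a b n)) (Cpow z n))).
    unfold PS_mult; rewrite <- minus_sum.
    transitivity (sum_f_R0 (fun k => a k * b (n - k)%nat * Re (Cpow z n)) n).
    + apply sum_eq; intros k Hk.
      rewrite <- (Re_scal (a k * b (n - k)%nat)), term, Re_Cmult by exact Hk; reflexivity.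
    + rewrite Re_scal, Rmult_comm, scal_sum; reflexivity.
  - apply is_series_unique.
    apply is_series_ext with (2 := is_series_plus _ _ _ _ (cauchy _ _ HRa HIb) (cauchy _ _ HIa HRb)).
    intros n; change (PS_mult (fun n0 => Re (U n0)) (fun n0 => Im (V n0)) n +
      PS_mult (fun n0 => Im (U n0)) (fun n0 => Re (V n0)) n = Im (Cmult (RtoC (PS_mult a b n)) (Cpow z n))).
    unfold PS_mult; rewrite <- sum_plus.
    transitivity (sum_f_R0 (fun k => a k * b (n - k)%nat * Im (Cpow z n)) n).
    + apply sum_eq; intros k Hk.
      rewrite <- (Im_scal (a k * b (n - k)%nat)), term, Im_Cmult by exact Hk; reflexivity.
    + rewrite Im_scal, Rmult_comm, scal_sum; reflexivity.
Qed.

Lemma CPSeries_minus (a b : nat -> R) (z : C) :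
  abs_cv a (Cmod z) -> abs_cv b (Cmod z) ->
  CPSeries (fun n => a n - b n) z = Cminus (CPSeries a z) (CPSeries b z).
Proof.
  intros Ha Hb; unfold CPSeries; rewrite <- CSeries_minus by now apply Csummable_CPSeries.
  apply CSeries_ext; intros n; rewrite RtoC_minus; ring.
Qed.

Lemma CPSeries_real (a : nat -> R) (x : R) : CPSeries a (RtoC x) = RtoC (PSeries a x).
Proof.
  unfold CPSeries, CSeries, RtoC at 5, PSeries; f_equal.
  - apply Series_ext; intros n; rewrite <- RtoC_pow; simpl; ring.
  - rewrite (Series_ext _ (fun n => 0 * 0)); [rewrite Series_scal_l; ring|].
    intros n; rewrite <- RtoC_pow; simpl; ring.
Qed.

(** Weights such as n and n^2 are absorbed by enlarging the radius fourfold, which costs nothing for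
    an entire series. *)
Lemma abs_cv_weight (a : nat -> R) (r : R) (w : nat -> R) : 0 <= r ->
  (forall n, 0 <= w n <= 4 ^ n) -> abs_cv a (4 * r) ->
  ex_series (fun n => Rabs (a n) * (w n * r ^ n)).
Proof.
  intros Hr Hw; apply (@ex_series_le R_AbsRing R_CompleteNormedModule).
  intros n; destruct (Hw n) as [H0 H4].
  assert (H1 := pow_le r n Hr); assert (H2 := Rabs_pos (a n)).
  change (Rabs (Rabs (a n) * (w n * r ^ n)) <= Rabs (a n) * (4 * r) ^ n).
  rewrite Rpow_mult_distr, Rabs_pos_eq by (repeat apply Rmult_le_pos; assumption).
  apply Rmult_le_compat_l; [exact H2|]; apply Rmult_le_compat_r; assumption.
Qed.

Lemma INR_sq_le_pow4 (n : nat) : INR n ^ 2 <= 4 ^ n.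
Proof.
  induction n as [|n IH]; [simpl; lra|].
  destruct n as [|n]; [simpl; lra|].
  assert (1 <= INR (S n)) by (rewrite S_INR; assert (H := pos_INR n); lra).
  rewrite (S_INR (S n)); change (4 ^ S (S n)) with (4 * 4 ^ S n); nra.
Qed.

Definition Cpow_deriv (z : C) (n : nat) : C :=
  match n with O => RtoC 0 | S m => Cmult (RtoC (INR n)) (Cpow z m) end.

(** The remainders satisfy E_(n+1) = (z + w) E_n + w^2 n z^(n-1), and n^2 r + n <= (n + 1)^2 r
    because r >= 1. *)
Lemma Cpow_taylor (z w : C) (r : R) (n : nat) : 1 <= r -> Cmod z <= r -> Cmod (Cplus z w) <= r ->
  Cmod (Cminus (Cminus (Cpow (Cplus z w) n) (Cpow z n)) (Cmult w (Cpow_deriv z n))) <=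
  Cmod w ^ 2 * (INR n ^ 2 * r ^ n).
Proof.
  intros Hr Hz Hw; induction n as [|n IH].
  - replace (Cminus _ _) with (RtoC 0) by (simpl; ring); rewrite Cmod_0; simpl; lra.
  - set (E := Cminus (Cminus (Cpow (Cplus z w) n) (Cpow z n)) (Cmult w (Cpow_deriv z n))) in *.
    assert (HE : Cminus (Cminus (Cpow (Cplus z w) (S n)) (Cpow z (S n)))
        (Cmult w (Cpow_deriv z (S n))) =
      Cplus (Cmult (Cplus z w) E) (Cmult (Cmult w w) (Cpow_deriv z n))).
    { unfold E; destruct n as [|n]; [simpl; ring|].
      unfold Cpow_deriv; rewrite (S_INR (S n)), RtoC_plus; simpl Cpow; ring. }
    rewrite HE; apply Rle_trans with (1 := Cmod_triangle _ _).
    rewrite !Cmod_mult.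
    assert (Hd : Cmod (Cpow_deriv z n) <= INR n * r ^ n).
    { destruct n as [|n]; unfold Cpow_deriv; [rewrite Cmod_0; simpl; lra|].
      rewrite Cmod_scal_pow, Rabs_pos_eq by apply pos_INR.
      apply Rmult_le_compat_l; [apply pos_INR|].
      assert (Hc : Cmod z ^ n <= r ^ n) by (apply pow_incr; split; [apply Cmod_ge_0 | exact Hz]).
      assert (0 <= Cmod z ^ n) by apply pow_le, Cmod_ge_0; simpl; nra. }
    assert (H1 : Cmod (Cplus z w) * Cmod E <= r * (Cmod w ^ 2 * (INR n ^ 2 * r ^ n))).
    { apply Rmult_le_compat; [apply Cmod_ge_0 | apply Cmod_ge_0 | exact Hw | exact IH]. }
    assert (H2 : Cmod w * Cmod w * Cmod (Cpow_deriv z n) <= Cmod w ^ 2 * (INR n * r ^ n)).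
    { replace (Cmod w * Cmod w) with (Cmod w ^ 2) by ring.
      apply Rmult_le_compat_l; [apply pow2_ge_0 | exact Hd]. }
    apply Rle_trans with (1 := Rplus_le_compat _ _ _ _ H1 H2).
    replace (r * (Cmod w ^ 2 * (INR n ^ 2 * r ^ n)) + Cmod w ^ 2 * (INR n * r ^ n))
      with (Cmod w ^ 2 * ((INR n ^ 2 * r + INR n) * r ^ n)) by ring.
    apply Rmult_le_compat_l; [apply pow2_ge_0|].
    rewrite S_INR; change (r ^ S n) with (r * r ^ n); rewrite <- Rmult_assoc.
    apply Rmult_le_compat_r; [apply pow_le; lra|].
    assert (Hn := pos_INR n); nra.
Qed.

(** Summing [Cpow_taylor] against the coefficients leaves a remainder of at most 2 M |w|^2 for |w| <
    1, with M the sum of |a_n| n^2 r^n and r = |z| + 1. *)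
Lemma is_derive_CPSeries (a : nat -> R) (z : C) : (forall r, 0 <= r -> abs_cv a r) ->
  @is_derive C_AbsRing C_NormedModule (CPSeries a) z (CPSeries (PS_derive a) z).
Proof.
  intros Ha; set (r := Cmod z + 1).
  assert (Hz0 := Cmod_ge_0 z).
  assert (Hr : 1 <= r) by (unfold r; lra).
  assert (Hcv2 : ex_series (fun n => Rabs (a n) * (INR n ^ 2 * r ^ n))).
  { apply abs_cv_weight; [lra | | apply Ha; lra].
    intros n; split; [apply pow2_ge_0 | apply INR_sq_le_pow4]. }
  set (M := Series (fun n => Rabs (a n) * (INR n ^ 2 * r ^ n))).
  assert (HM : 0 <= M).
  { unfold M; rewrite <- (Rmult_0_l (Series (fun _ => 0))), <- Series_scal_l.
    apply Series_le; [|exact Hcv2]; intros n; split; [lra|].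
    rewrite Rmult_0_l; apply Rmult_le_pos; [apply Rabs_pos|].
    apply Rmult_le_pos; [apply pow2_ge_0 | apply pow_le; lra]. }
  assert (Hder : CPSeries (PS_derive a) z =
    CSeries (fun n => Cmult (RtoC (a n)) (Cpow_deriv z n))).
  { unfold CPSeries, CSeries; f_equal.
    - rewrite (Series_incr_1_aux (fun n => Re (Cmult (RtoC (a n)) (Cpow_deriv z n))))
        by (simpl; ring).
      apply Series_ext; intros n; unfold PS_derive, Cpow_deriv; rewrite !Re_scal; ring.
    - rewrite (Series_incr_1_aux (fun n => Im (Cmult (RtoC (a n)) (Cpow_deriv z n))))
        by (simpl; ring).
      apply Series_ext; intros n; unfold PS_derive, Cpow_deriv; rewrite !Im_scal; ring. }
  assert (Hsd : Csummable (fun n => Cmult (RtoC (a n)) (Cpow_deriv z n))).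
  { apply Csummable_le with (2 := Hcv2); intros n.
    rewrite Cmod_mult, Cmod_R; apply Rmult_le_compat_l; [apply Rabs_pos|].
    destruct n as [|n]; unfold Cpow_deriv; [rewrite Cmod_0; simpl; lra|].
    rewrite Cmod_scal_pow, Rabs_pos_eq by apply pos_INR.
    assert (H1 : 1 <= INR (S n)) by (rewrite S_INR; assert (H := pos_INR n); lra).
    assert (Hc : Cmod z ^ n <= r ^ n) by (apply pow_incr; unfold r; lra).
    assert (0 <= Cmod z ^ n) by now apply pow_le.
    apply Rmult_le_compat; [lra | assumption | nra | simpl; nra]. }
  assert (main : forall w, Cmod w < 1 ->
    Cmod (Cminus (Cminus (CPSeries a (Cplus z w)) (CPSeries a z))
      (Cmult w (CPSeries (PS_derive a) z))) <= Cmod w ^ 2 * (2 * M)).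
  { intros w Hw; rewrite Hder.
    assert (Hzw : Cmod (Cplus z w) <= r).
    { apply Rle_trans with (1 := Cmod_triangle z w); unfold r; lra. }
    assert (S1 := Csummable_CPSeries a (Cplus z w) (Ha _ (Cmod_ge_0 _))).
    assert (S2 := Csummable_CPSeries a z (Ha _ (Cmod_ge_0 _))).
    rewrite <- CSeries_scal by exact Hsd.
    assert (S3 : Csummable (fun n => Cmult w (Cmult (RtoC (a n)) (Cpow_deriv z n)))).
    { apply ex_series_ext with (fun n => Cmod w * Cmod (Cmult (RtoC (a n)) (Cpow_deriv z n))).
      - intros n; symmetry; apply Cmod_mult.
      - exact (ex_series_scal_l (Cmod w) _ Hsd). }
    unfold CPSeries; rewrite <- CSeries_minus by assumption.
    assert (bound : forall n, Cmod (Cminus (Cminus (Cmult (RtoC (a n)) (Cpow (Cplus z w) n))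
        (Cmult (RtoC (a n)) (Cpow z n))) (Cmult w (Cmult (RtoC (a n)) (Cpow_deriv z n)))) <=
        Cmod w ^ 2 * (Rabs (a n) * (INR n ^ 2 * r ^ n))).
    { intros n.
      replace (Cminus _ _) with (Cmult (RtoC (a n)) (Cminus (Cminus (Cpow (Cplus z w) n)
        (Cpow z n)) (Cmult w (Cpow_deriv z n)))) by ring.
      rewrite Cmod_mult, Cmod_R.
      replace (Cmod w ^ 2 * (Rabs (a n) * (INR n ^ 2 * r ^ n))) with
        (Rabs (a n) * (Cmod w ^ 2 * (INR n ^ 2 * r ^ n))) by ring.
      apply Rmult_le_compat_l; [apply Rabs_pos|].
      apply Cpow_taylor; [exact Hr | unfold r; lra | exact Hzw]. }
    assert (Hex : ex_series (fun n => Cmod w ^ 2 * (Rabs (a n) * (INR n ^ 2 * r ^ n)))).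
    { exact (ex_series_scal_l (Cmod w ^ 2) _ Hcv2). }
    assert (S12 : Csummable (fun n => Cminus (Cmult (RtoC (a n)) (Cpow (Cplus z w) n))
        (Cmult (RtoC (a n)) (Cpow z n)))).
    { apply Csummable_le with (2 := ex_series_plus _ _ S1 S2); intros n.
      apply Rle_trans with (1 := Cmod_triangle _ _); rewrite Cmod_opp; apply Rle_refl. }
    rewrite <- CSeries_minus by assumption.
    apply Rle_trans with (1 := Cmod_CSeries _ (Csummable_le _ _ bound Hex)).
    replace (Cmod w ^ 2 * (2 * M)) with (2 * (Cmod w ^ 2 * M)) by ring.
    apply Rmult_le_compat_l; [lra|]; unfold M; rewrite <- Series_scal_l.
    apply Series_le; [|exact Hex]; intros n; split; [apply Cmod_ge_0 | apply bound]. }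
  split; [apply is_linear_scal_l|].
  intros x Hx.
  assert (Hx' := is_filter_lim_locally_unique _ _ Hx); subst x.
  intros eps.
  (* The summand 1 in the denominator covers the case M = 0. *)
  assert (Hd : 0 < Rmin 1 (eps / (2 * M + 1))).
  { apply Rmin_pos; [lra|]; apply Rdiv_lt_0_compat; [apply cond_pos | lra]. }
  exists (mkposreal _ Hd); intros y Hy.
  change (Cmod (Cminus y z) < Rmin 1 (eps / (2 * M + 1))) in Hy.
  change (Cmod (Cminus (Cminus (CPSeries a y) (CPSeries a z))
    (Cmult (Cminus y z) (CPSeries (PS_derive a) z))) <= eps * Cmod (Cminus y z)).
  set (w := Cminus y z) in *.
  assert (Hw1 : Cmod w < 1) by apply (Rlt_le_trans _ _ _ Hy), Rmin_l.
  assert (Hw2 : Cmod w * (2 * M + 1) <= eps).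
  { assert (H : Cmod w < eps / (2 * M + 1)) by apply (Rlt_le_trans _ _ _ Hy), Rmin_r.
    apply (Rmult_lt_compat_r (2 * M + 1)) in H; [|lra].
    unfold Rdiv in H; rewrite Rmult_assoc, Rinv_l in H by lra; lra. }
  assert (H := main w Hw1).
  assert (Hy' : Cplus z w = y) by (unfold w; change (@eq C (Cplus z (Cminus y z)) y); ring).
  rewrite Hy' in H.
  apply Rle_trans with (1 := H).
  assert (H0 := Cmod_ge_0 w); nra.
Qed.

(** * The Jackson q-Bessel function and the radius of starlikeness *)

(** The Weierstrass inequality prod (1 - y_i) >= 1 - sum y_i for the factors from index [m] on, with
    the geometric sum in closed form. *)
Lemma qpoch_tail_ge (a q : R) (m n : nat) : 0 < q < 1 -> 0 < a < 1 ->
  qpoch a q m * (1 - a * q ^ m * (1 - q ^ n) / (1 - q)) <= qpoch a q (n + m).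
Proof.
  intros Hq Ha; assert (Hm := qpoch_pos a q m Hq Ha).
  assert (Hqm := pow_lt_1 q m Hq).
  induction n as [|n IH]; simpl (_ + m)%nat.
  - right; simpl; field; lra.
  - simpl qpoch; rewrite pow_add.
    set (s := a * q ^ m * (1 - q ^ n) / (1 - q)) in *.
    set (y := a * (q ^ n * q ^ m)).
    assert (Hqn := pow_lt_1 q n Hq).
    assert (Hy : 0 <= y <= 1).
    { unfold y; assert (0 < q ^ n * q ^ m <= 1) by nra; nra. }
    assert (Hs : 0 <= s).
    { apply Rmult_le_pos; [|apply Rlt_le, Rinv_0_lt_compat; lra].
      repeat apply Rmult_le_pos; lra. }
    replace (a * q ^ m * (1 - q ^ S n) / (1 - q)) with (s + y) by
      (unfold s, y; simpl; field; lra).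
    apply Rle_trans with (qpoch a q m * (1 - s) * (1 - y)).
    + rewrite Rmult_assoc; apply Rmult_le_compat_l; [lra | nra].
    + apply Rmult_le_compat_r; [lra | exact IH].
Qed.

Lemma qpoch_inf_pos (a q : R) : 0 < q < 1 -> 0 < a < 1 -> 0 < qpoch_inf a q.
Proof.
  intros Hq Ha.
  assert (Hgeom : is_lim_seq (fun n => q ^ n) 0) by (apply is_lim_seq_geom; rewrite Rabs_pos_eq; lra).
  apply is_lim_seq_spec in Hgeom.
  (* Once q^m < (1 - q) / 2, the geometric sum in [qpoch_tail_ge] is at most 1/2, and the infinite
     product keeps at least half of its m-th partial product. *)
  assert (He : 0 < (1 - q) / 2) by lra.
  destruct (Hgeom (mkposreal _ He)) as [m Hm].
  specialize (Hm m (le_n m)); simpl in Hm.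
  assert (Hqm := pow_lt_1 q m Hq).
  rewrite Rminus_0_r, Rabs_pos_eq in Hm by lra.
  assert (Hlim : ex_finite_lim_seq (fun n => qpoch a q n)).
  { apply ex_finite_lim_seq_decr with (M := 0); intros n;
      assert (H := qpoch_pos a q n Hq Ha); [|lra].
    assert (Hn := pow_lt_1 q n Hq); assert (0 < a * q ^ n) by nra; simpl; nra. }
  destruct Hlim as [l Hl].
  unfold qpoch_inf; rewrite (is_lim_seq_unique _ _ Hl); simpl.
  assert (Hmp := qpoch_pos a q m Hq Ha).
  apply Rlt_le_trans with (qpoch a q m / 2); [lra|].
  apply (is_lim_seq_incr_n _ m) in Hl.
  refine (is_lim_seq_le (fun _ => qpoch a q m / 2) _ (qpoch a q m / 2) l _
    (is_lim_seq_const _) Hl).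
  intros n; apply Rle_trans with (2 := qpoch_tail_ge a q m n Hq Ha).
  unfold Rdiv at 1; apply Rmult_le_compat_l; [lra|].
  assert (Hn := pow_lt_1 q n Hq).
  assert (a * q ^ m * (1 - q ^ n) / (1 - q) <= / 2); [|lra].
  apply (Rmult_le_reg_r (1 - q)); [lra|].
  replace (a * q ^ m * (1 - q ^ n) / (1 - q) * (1 - q)) with (a * q ^ m * (1 - q ^ n))
    by (field; lra).
  assert (H1 : a * q ^ m <= (1 - q) / 2) by nra.
  assert (H2 : 0 < a * q ^ m) by nra.
  nra.
Qed.

(** Turns every real power of the statement into natural powers of Q = q^(nu+1) and [q], on which
    [ring] and [field] operate. *)
Lemma Rpower_base_change (q b x : R) (k m : nat) : 0 < q ->
  x = INR k * b + INR m -> Rpower q x = Rpower q b ^ k * q ^ m.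
Proof.
  intros Hq ->.
  rewrite Rpower_plus, Rpower_pow by exact Hq.
  rewrite Rmult_comm with (r1 := INR k), <- Rpower_mult, Rpower_pow by apply exp_pos.
  reflexivity.
Qed.

Lemma Rpower_lt_1 (q b : R) : 0 < q < 1 -> 0 < b -> 0 < Rpower q b < 1.
Proof.
  intros Hq Hb; split; [apply exp_pos|].
  rewrite <- exp_0; apply exp_increasing.
  assert (ln q < 0) by (rewrite <- ln_1; apply ln_increasing; lra); nra.
Qed.

Lemma bessel_gauss_factor (q nu : R) (n : nat) : 0 < q ->
  Rpower q (INR n * (INR n + nu)) = q ^ (n * (n - 1)) * Rpower q (nu + 1) ^ n.
Proof.
  intros Hq; rewrite (Rpower_base_change q (nu + 1) _ n (n * (n - 1))); [ring | exact Hq|].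
  destruct n as [|n]; [simpl; ring|].
  replace (S n - 1)%nat with n by lia; rewrite mult_INR, S_INR; ring.
Qed.

Lemma CV_radius_bessel (q Q : R) : 0 < q < 1 -> 0 < Q < 1 ->
  CV_radius (bessel_coef q Q) = p_infty.
Proof.
  intros Hq HQ; apply CV_radius_infinite_DAlembert.
  { intros n; now apply bessel_coef_neq0. }
  set (B := / (4 * (1 - q) * (1 - Q))).
  assert (HB : 0 < B) by (apply Rinv_0_lt_compat; repeat apply Rmult_lt_0_compat; lra).
  apply is_lim_seq_le_le with (u := fun _ => 0) (w := fun n => B * q ^ n);
    [|apply is_lim_seq_const|].
  - intros n; split; [apply Rabs_pos|].
    assert (Hn := bessel_coef_neq0 q Q n Hq HQ).
    rewrite bessel_coef_succ by assumption.
    unfold Rdiv at 1; rewrite Rmult_assoc, Rinv_r, Rmult_1_r, Rabs_Ropp by exact Hn.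
    assert (Hqn := pow_lt_1 q n Hq).
    assert (D1 : 0 < (1 - q) * (1 - Q)) by nra.
    assert (D2 : (1 - q) * (1 - Q) <= (1 - q * q ^ n) * (1 - Q * q ^ n)).
    { apply Rmult_le_compat; nra. }
    replace (q ^ (2 * n)) with (q ^ n * q ^ n) by (rewrite <- pow_add; f_equal; lia).
    rewrite Rabs_pos_eq.
    + rewrite (Rmult_comm B); unfold Rdiv, B; apply Rmult_le_compat; [nra | | | ].
      * apply Rlt_le, Rinv_0_lt_compat; nra.
      * rewrite Rmult_assoc; assert (q ^ n * Q <= 1) by nra; nra.
      * apply Rinv_le_contravar; nra.
    + apply Rlt_le, Rdiv_lt_0_compat; [|nra].
      repeat apply Rmult_lt_0_compat; lra.
  - replace (Finite 0) with (Finite (B * 0)) by (f_equal; ring).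
    apply (is_lim_seq_scal_l _ B (Finite 0)), is_lim_seq_geom; rewrite Rabs_pos_eq; lra.
Qed.

Lemma Defs_Cpow (z : C) (n : nat) : Defs.Cpow z n = Cpow z n.
Proof. induction n as [|n IH]; simpl; [reflexivity|]; rewrite IH; ring. Qed.

Lemma h_nu2_CPSeries (q nu : R) (z : C) : 0 < q ->
  h_nu2 nu q z = CPSeries (shift (bessel_coef q (Rpower q (nu + 1)))) z.
Proof.
  intros Hq; unfold h_nu2, CPSeries, CSeries; f_equal.
  - rewrite (Series_incr_1_aux (fun n => Re (Cmult (RtoC (shift _ n)) (Cpow z n))))
      by (simpl; ring).
    apply Series_ext; intros n; rewrite Defs_Cpow, bessel_gauss_factor, (pow_mult 2 2 n) by exact Hq.
    replace (2 ^ 2) with 4 by ring; reflexivity.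
  - rewrite (Series_incr_1_aux (fun n => Im (Cmult (RtoC (shift _ n)) (Cpow z n))))
      by (simpl; ring).
    apply Series_ext; intros n; rewrite Defs_Cpow, bessel_gauss_factor, (pow_mult 2 2 n) by exact Hq.
    replace (2 ^ 2) with 4 by ring; reflexivity.
Qed.

Lemma CPSeries_shift (a : nat -> R) (z : C) : abs_cv a (Cmod z) ->
  CPSeries (shift a) z = Cmult z (CPSeries a z).
Proof.
  intros Ha; unfold CPSeries at 2; rewrite <- CSeries_scal by now apply Csummable_CPSeries.
  unfold CPSeries, CSeries; f_equal.
  - rewrite Series_incr_1_aux by (simpl; ring).
    apply Series_ext; intros n; f_equal; simpl shift; rewrite Cpow_S; ring.
  - rewrite Series_incr_1_aux by (simpl; ring).
    apply Series_ext; intros n; f_equal; simpl shift; rewrite Cpow_S; ring.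
Qed.

(** Newton's identities summed as series: z F' = - P F on the real line. *)
Lemma PSeries_log_derivative (f p : nat -> R) (y : R) :
  (forall n, PS_mult p f n = - INR n * f n) ->
  Rbar_lt (Rabs y) (CV_radius p) -> Rbar_lt (Rabs y) (CV_radius f) ->
  y * PSeries (PS_derive f) y = - (PSeries p y * PSeries f y).
Proof.
  intros Hpf Hp Hf.
  rewrite <- PSeries_mult, <- PSeries_incr_1, <- PSeries_opp by assumption.
  apply Series_ext; intros n; f_equal; unfold PS_opp; rewrite Hpf.
  destruct n as [|n]; unfold PS_incr_1, PS_derive;
    [change (0 = - (- 0 * f 0%nat)) | change (INR (S n) * f (S n) = - (- INR (S n) * f (S n)))]; ring.
Qed.

Lemma jackson_J2_PSeries (q nu x : R) : 0 < q -> 0 < x ->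
  jackson_J2 nu q x = qpoch_inf (Rpower q (nu + 1)) q / qpoch_inf q q *
    (Rpower (x / 2) nu * PSeries (bessel_coef q (Rpower q (nu + 1))) (x ^ 2)).
Proof.
  intros Hq Hx; unfold jackson_J2, PSeries; f_equal; rewrite <- Series_scal_l.
  apply Series_ext; intros n; rewrite bessel_gauss_factor by exact Hq.
  replace (2 * INR n + nu) with (nu + INR (2 * n)) by (rewrite mult_INR; simpl; ring).
  rewrite Rpower_plus, Rpower_pow by lra.
  rewrite (pow_mult (x / 2) 2 n); replace ((x / 2) ^ 2) with (x ^ 2 * / 4) by field.
  rewrite Rpow_mult_distr, pow_inv; unfold bessel_coef, Rdiv.
  rewrite !Rinv_mult; ring.
Qed.

(** Up to a constant J(x) is (x/2)^nu F(x^2), and x d/dx of this brings out nu F + 2 x^2 F'.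
    Subtracting (nu - 2) F leaves 2 (F + x^2 F'), that is, twice h' at x^2. *)
Lemma jackson_J2_equation (q nu x : R) : 0 < q < 1 -> -1 < nu -> 0 < x ->
  let f := bessel_coef q (Rpower q (nu + 1)) in
  x * Derive (jackson_J2 nu q) x - (nu - 2) * jackson_J2 nu q x =
  2 * (qpoch_inf (Rpower q (nu + 1)) q / qpoch_inf q q) * Rpower (x / 2) nu *
  (PSeries f (x ^ 2) + x ^ 2 * PSeries (PS_derive f) (x ^ 2)).
Proof.
  intros Hq Hnu Hx f; set (K := qpoch_inf (Rpower q (nu + 1)) q / qpoch_inf q q).
  assert (HQ := Rpower_lt_1 q (nu + 1) Hq ltac:(lra)).
  assert (D1 : is_derive (fun y => Rpower (y / 2) nu) x (Rpower (x / 2) nu * (nu / x))).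
  { unfold Rpower; auto_derive; [lra|]. unfold Rdiv; field; lra. }
  assert (D2 : is_derive (fun y => y ^ 2) x (2 * x)) by (auto_derive; [easy | ring]).
  assert (D3 : is_derive (PSeries f) (x ^ 2) (PSeries (PS_derive f) (x ^ 2))).
  { apply is_derive_PSeries; unfold f; rewrite CV_radius_bessel by assumption; exact I. }
  assert (D4 := is_derive_comp (PSeries f) (fun y => y ^ 2) x _ _ D3 D2).
  assert (D5 := is_derive_scal _ x K _ (is_derive_mult _ _ x _ _ D1 D4 Rmult_comm)).
  rewrite (Derive_ext_loc (jackson_J2 nu q)
    (fun y => K * (Rpower (y / 2) nu * PSeries f (y ^ 2)))).
  - transitivity (x * (K * (Rpower (x / 2) nu * (nu / x) * PSeries f (x ^ 2) +
      Rpower (x / 2) nu * (2 * x * PSeries (PS_derive f) (x ^ 2)))) -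
      (nu - 2) * jackson_J2 nu q x).
    + f_equal; f_equal; exact (is_derive_unique _ _ _ D5).
    + rewrite jackson_J2_PSeries by lra; fold f K; field; lra.
  (* The ball of radius [x] about [x] contains only positive points, where the series formula for J
     is available. *)
  - exists (mkposreal x Hx); intros y Hy.
    change (Rabs (y - x) < x) in Hy; apply Rabs_def2 in Hy.
    apply jackson_J2_PSeries; lra.
Qed.

(** At z = r the derivative vanishes, so the quotient has real part 0 there, and no disc of radius
    larger than [r] is admissible. *)
Lemma radius_starlike_eq (h : C -> C) (r : R) :
  0 < r ->
  (forall z, 0 < Cmod z < r -> exists l, @is_derive C_AbsRing C_NormedModule h z l /\
     0 < Re (Cdiv (Cmult z l) (h z))) ->
  @is_derive C_AbsRing C_NormedModule h (RtoC r) (RtoC 0) ->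
  radius_starlike h = Finite r.
Proof.
  intros Hr Hin Hout; apply is_lub_Rbar_unique; split.
  - intros s [Hs H]; apply Rnot_lt_le; intros Hrs.
    destruct (H (RtoC r)) as [l [Hl Hpos]].
    { rewrite Cmod_R, Rabs_pos_eq; lra. }
    apply is_C_derive_unique in Hl; apply is_C_derive_unique in Hout.
    rewrite <- Hl, Hout in Hpos; unfold Cdiv in Hpos.
    rewrite Cmult_0_r, Cmult_0_l in Hpos; simpl in Hpos; lra.
  - intros b Hb; apply Hb; split; assumption.
Qed.

(** * Starlikeness through the logarithmic derivative *)

Section Starlike.
Variables (f p g : nat -> R) (r : R).
Hypotheses (Hpf : forall n, PS_mult p f n = - INR n * f n)
  (Hgf : forall n, PS_mult g f n = unit_coef n)
  (Hg : forall n, 0 <= g n <= p 1%nat ^ n)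
  (Hp : forall n, 0 <= p n) (Hp1 : 0 < p 1%nat)
  (Hcv : forall x, Rabs x * p 1%nat <= 1 -> Rbar_lt (Rabs x) (CV_radius p))
  (Hf : CV_radius f = p_infty)
  (Hr0 : 0 < r) (Hr1 : r * p 1%nat < 1) (HPr : PSeries p r = 1)
  (HPlt : forall x, 0 <= x < r -> PSeries p x < 1).

Lemma abs_cv_entire (a : nat -> R) (x : R) : CV_radius a = p_infty -> 0 <= x -> abs_cv a x.
Proof. intros Ha Hx; apply abs_cv_CV_radius; [exact Hx|]; rewrite Ha; exact I. Qed.

Lemma abs_cv_rayleigh (x : R) : 0 <= x -> x * p 1%nat <= 1 -> abs_cv p x.
Proof.
  intros Hx Hx1; apply abs_cv_CV_radius; [exact Hx|]; apply Hcv.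
  rewrite Rabs_pos_eq; assumption.
Qed.

(** On this disc the reciprocal series G = sum g_n z^n converges, and G F = 1. *)
Lemma CPSeries_neq0 (z : C) : Cmod z * p 1%nat < 1 -> CPSeries f z <> RtoC 0.
Proof.
  intros Hz H0; assert (Hz0 := Cmod_ge_0 z).
  assert (Hgz : abs_cv g (Cmod z)).
  { apply abs_cv_CV_radius; [exact Hz0|].
    apply CV_radius_gt_geom with (M := 1) (t := p 1%nat);
      [exact Hp1 | | rewrite Rabs_pos_eq; assumption].
    intros n; rewrite Rabs_pos_eq, Rmult_1_l; apply Hg. }
  assert (H1 := CPSeries_mult g f z Hgz (abs_cv_entire f _ Hf Hz0)).
  rewrite H0, Cmult_0_r in H1.
  assert (H2 : CPSeries (PS_mult g f) z = RtoC 1).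
  { transitivity (CPSeries unit_coef (RtoC 0)).
    - apply CSeries_ext; intros n; rewrite Hgf.
      destruct n as [|n]; simpl unit_coef; [reflexivity|]; rewrite !Cmult_0_l; reflexivity.
    - rewrite CPSeries_real, PSeries_0; reflexivity. }
  rewrite H2 in H1; injection H1; lra.
Qed.

(** Coefficientwise, (z F)' has (n + 1) f_n = f_n - (p f)_n by Newton's identities, the product
    being a convolution. *)
Lemma CPSeries_derive_shift (z : C) : Cmod z * p 1%nat <= 1 ->
  CPSeries (PS_derive (shift f)) z =
  Cmult (CPSeries f z) (Cminus (RtoC 1) (CPSeries p z)).
Proof.
  intros Hz; assert (Hz0 := Cmod_ge_0 z).
  assert (Hfz := abs_cv_entire f _ Hf Hz0).
  assert (Hpf' : abs_cv (PS_mult p f) (Cmod z)).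
  { apply ex_series_ext with (fun n => Rabs (f n) * (INR n * Cmod z ^ n)).
    - intros n; rewrite Hpf, Rabs_mult, Rabs_Ropp, (Rabs_pos_eq (INR n)) by apply pos_INR.
      rewrite <- Rmult_assoc, (Rmult_comm (Rabs (f n))); reflexivity.
    - apply abs_cv_weight; [exact Hz0 | | apply abs_cv_entire; [exact Hf | lra]].
      intros n; split; [apply pos_INR|].
      apply Rle_trans with (2 := INR_sq_le_pow4 n).
      destruct n as [|n]; [simpl; lra|].
      assert (1 <= INR (S n)) by (rewrite S_INR; assert (H := pos_INR n); lra); nra. }
  transitivity (CPSeries (fun n => f n - PS_mult p f n) z).
  - apply CSeries_ext; intros n; do 2 f_equal; rewrite Hpf.
    unfold PS_derive; simpl shift; rewrite S_INR; ring.
  - rewrite CPSeries_minus, CPSeries_mult by (assumption || now apply abs_cv_rayleigh); ring.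
Qed.

Lemma radius_starlike_shift (h : C -> C) : (forall z, h z = CPSeries (shift f) z) ->
  radius_starlike h = Finite r.
Proof.
  intros Hh.
  assert (Hshift : CV_radius (shift f) = p_infty).
  { rewrite <- Hf; apply (CV_radius_incr_1 f). }
  assert (Hder : forall z, @is_derive C_AbsRing C_NormedModule h z (CPSeries (PS_derive (shift f)) z)).
  { intros z; apply is_derive_ext with (f := CPSeries (shift f)); [intros; symmetry; apply Hh|].
    apply is_derive_CPSeries; intros x Hx; now apply abs_cv_entire. }
  apply radius_starlike_eq; [exact Hr0 | |].
  - intros z [Hz0 Hz]; eexists; split; [apply Hder|].
    assert (Hz1 : Cmod z * p 1%nat < 1).
    { apply Rlt_trans with (2 := Hr1), Rmult_lt_compat_r; assumption. }
    assert (Hzn : z <> RtoC 0) by now apply Cmod_gt_0.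
    assert (HFn := CPSeries_neq0 z Hz1).
    rewrite Hh, CPSeries_shift, CPSeries_derive_shift by
      (apply Rlt_le, Hz1 || (apply abs_cv_entire; [exact Hf | apply Cmod_ge_0])).
    (* After cancelling z F(z) only 1 - P(z) remains, and |Re P(z)| <= P(|z|) < 1 since the p_n are
       nonnegative. *)
    replace (Cdiv _ _) with (Cminus (RtoC 1) (CPSeries p z)) by (field; split; assumption).
    assert (Habs := abs_cv_rayleigh (Cmod z) (Rlt_le _ _ Hz0) (Rlt_le _ _ Hz1)).
    assert (HRe := Rabs_Re_CSeries _ (Csummable_CPSeries p z Habs)).
    rewrite (Series_ext _ (fun n => p n * Cmod z ^ n)) in HRe.
    + assert (HP := HPlt (Cmod z) (conj (Rlt_le _ _ Hz0) Hz)).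
      apply Rabs_le_between in HRe; fold (CPSeries p z) in HRe; unfold PSeries in HP.
      change (0 < 1 + - Re (CPSeries p z)); lra.
    + intros n; rewrite Cmod_scal_pow, Rabs_pos_eq; [reflexivity | apply Hp].
  - replace (RtoC 0) with (CPSeries (PS_derive (shift f)) (RtoC r)); [apply Hder|].
    rewrite CPSeries_derive_shift by (rewrite Cmod_R, Rabs_pos_eq; lra).
    rewrite (CPSeries_real p), HPr; ring.
Qed.
End Starlike.

(** Newton's identities in degrees 1, 2, 3 express the Rayleigh sums through the first coefficients.
    The second and third power sums for h' then produce [Dpoly] and the negative of [cpoly] +
    [dpoly], written in [Q] and [q]. *)
Lemma bessel_rayleigh_values (q Q : R) (p : nat -> R) : 0 < q < 1 -> 0 < Q < 1 ->
  p O = 0 -> (forall k, PS_mult p (bessel_coef q Q) k = - INR k * bessel_coef q Q k) ->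
  p 1%nat = Q / (4 * (1 - q) * (1 - Q)) /\
  0 < p 2%nat < p 1%nat ^ 2 /\
  p 1%nat ^ 2 + 3 * p 2%nat =
    Q ^ 2 * (2 * q - 2 * (Q * q) + Q * q ^ 2 - 3 * q ^ 2 + 2) /
    (8 * (1 - q) ^ 2 * (1 - Q) ^ 2 * (1 + q) * (1 - Q * q)) /\
  4 * p 3%nat + 3 * p 1%nat * p 2%nat + p 1%nat ^ 3 =
    - (Q ^ 3 * (4 * (Q * q) + 3 * (Q * q ^ 2) + 7 * (Q * q ^ 3) - 6 * (Q * q ^ 4)
        - 5 * (Q * q ^ 5) + 3 * (Q * q ^ 6) - 4 * (Q ^ 2 * q ^ 3) + Q ^ 2 * q ^ 4
        + (Q ^ 2 * q ^ 5 - Q ^ 2 * q ^ 6 - 8 * q + q ^ 2 + 5 * q ^ 3 + 9 * q ^ 4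
           - 6 * q ^ 6 - 4))) /
    (32 * (1 - q) ^ 2 * (1 - Q) ^ 3 * (1 + q) * (1 - Q * q) * (1 - Q * q ^ 2) * (1 - q ^ 3)).
Proof.
  intros Hq HQ Hp0 Hp.
  assert (H1 := Hp 1%nat); assert (H2 := Hp 2%nat); assert (H3 := Hp 3%nat).
  unfold PS_mult in H1, H2, H3; simpl in H1, H2, H3.
  rewrite Hp0 in H1, H2, H3; rewrite bessel_coef_0 in H1, H2, H3.
  assert (HQq : 0 < Q * q < 1) by nra.
  assert (HQq2 : 0 < Q * q ^ 2 < 1) by nra.
  assert (Hq2 : 0 < q ^ 2 < 1) by nra.
  assert (Hq3 : 0 < q ^ 3 < 1) by nra.
  assert (F1 : bessel_coef q Q 1 = - (Q / (4 * (1 - q) * (1 - Q)))).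
  { unfold bessel_coef; simpl; field; lra. }
  assert (F2 : bessel_coef q Q 2 =
    q ^ 2 * Q ^ 2 / (16 * (1 - q) * (1 - q ^ 2) * (1 - Q) * (1 - Q * q))).
  { unfold bessel_coef; simpl; field; repeat split; lra. }
  assert (F3 : bessel_coef q Q 3 = - (q ^ 6 * Q ^ 3 /
    (64 * (1 - q) * (1 - q ^ 2) * (1 - q ^ 3) * (1 - Q) * (1 - Q * q) * (1 - Q * q ^ 2)))).
  { unfold bessel_coef; simpl; field; repeat split; lra. }
  assert (P1 : p 1%nat = Q / (4 * (1 - q) * (1 - Q))) by lra.
  assert (P2 : p 2%nat = p 1%nat ^ 2 - 2 * bessel_coef q Q 2) by (rewrite P1 in *; rewrite F1 in H2; nra).
  assert (P3 : p 3%nat = p 1%nat ^ 3 - 3 * p 1%nat * bessel_coef q Q 2 - 3 * bessel_coef q Q 3).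
  { assert (E1 : bessel_coef q Q 1 = - p 1%nat) by lra.
    rewrite E1, P2 in H3; nra. }
  assert (N2 : p 2%nat = Q ^ 2 * ((1 + q) * (1 - Q * q) - 2 * q ^ 2 * (1 - Q)) /
    (16 * (1 - q) ^ 2 * (1 - Q) ^ 2 * (1 + q) * (1 - Q * q))).
  { rewrite P2, P1, F2; field; repeat split; nra. }
  split; [exact P1|]; split; [split|split].
  - rewrite N2; apply Rdiv_lt_0_compat.
    + apply Rmult_lt_0_compat; [nra|].
      (* The numerator of p_2 is positive because 1 - Q <= 1 - Q q and 2 q^2 < 1 + q. *)
      assert (1 - Q <= 1 - Q * q) by nra.
      assert (0 < 1 + q - 2 * q ^ 2) by nra.
      nra.
    + repeat apply Rmult_lt_0_compat; try lra; apply pow_lt; lra.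
  - rewrite P2; assert (0 < bessel_coef q Q 2); [|lra].
    rewrite F2; apply Rdiv_lt_0_compat; repeat apply Rmult_lt_0_compat; lra.
  - rewrite N2, P1; field; repeat split; lra.
  - rewrite P3, P2, P1, F2, F3; field; repeat split; nra.
Qed.

Theorem theorem3 (q nu : R) (hq0 : 0 < q) (hq1 : q < 1) (hnu : -1 < nu) :
  exists rho : R,
    0 < rho /\
    rho * Derive (jackson_J2 nu q) rho - (nu - 2) * jackson_J2 nu q rho = 0 /\
    (forall s : R, 0 < s < rho ->
       s * Derive (jackson_J2 nu q) s - (nu - 2) * jackson_J2 nu q s <> 0) /\
    radius_starlike (h_nu2 nu q) = Finite (rho ^ 2) /\
    2 * (1 - q) * (1 - Rpower q (nu + 1)) / Rpower q (nu + 1) < rho ^ 2 /\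
    rho ^ 2 < 4 * (Rpower q (nu + 1) - 1) * (Rpower q (nu + 2) - 1) * (1 - q ^ 2)
              / (Rpower q (nu + 1) * Dpoly nu q) /\
    sqrt (8 * (Rpower q (nu + 1) - 1) ^ 2 * (1 - Rpower q (nu + 2))
            * (q - 1) ^ 2 * (q + 1)
          / (Rpower q (2 * nu + 2) * Dpoly nu q)) < rho ^ 2 /\
    rho ^ 2 < 4 * (Rpower q (nu + 1) - 1) * (Rpower q (nu + 3) - 1) * (q ^ 3 - 1)
              / Rpower q (nu + 1) * q2star nu q.
Proof.
  assert (Hq : 0 < q < 1) by lra.
  assert (HQ := Rpower_lt_1 q (nu + 1) Hq ltac:(lra)).
  unfold q2star, cpoly, dpoly, Dpoly.
  rewrite (Rpower_base_change q (nu + 1) (nu + 2) 1 1) by (simpl; lra).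
  rewrite (Rpower_base_change q (nu + 1) (nu + 3) 1 2) by (simpl; lra).
  rewrite (Rpower_base_change q (nu + 1) (nu + 4) 1 3) by (simpl; lra).
  rewrite (Rpower_base_change q (nu + 1) (nu + 5) 1 4) by (simpl; lra).
  rewrite (Rpower_base_change q (nu + 1) (nu + 6) 1 5) by (simpl; lra).
  rewrite (Rpower_base_change q (nu + 1) (nu + 7) 1 6) by (simpl; lra).
  rewrite (Rpower_base_change q (nu + 1) (2 * nu + 2) 2 0) by (simpl; lra).
  rewrite (Rpower_base_change q (nu + 1) (2 * nu + 5) 2 3) by (simpl; lra).
  rewrite (Rpower_base_change q (nu + 1) (2 * nu + 6) 2 4) by (simpl; lra).
  rewrite (Rpower_base_change q (nu + 1) (2 * nu + 7) 2 5) by (simpl; lra).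
  rewrite (Rpower_base_change q (nu + 1) (2 * nu + 8) 2 6) by (simpl; lra).
  assert (HJ := fun x => jackson_J2_equation q nu x Hq hnu).
  assert (Hh := fun z => h_nu2_CPSeries q nu z hq0).
  assert (HK : 0 < qpoch_inf (Rpower q (nu + 1)) q / qpoch_inf q q).
  { apply Rdiv_lt_0_compat; now apply qpoch_inf_pos. }
  set (Q := Rpower q (nu + 1)) in *.
  destruct (bessel_rayleigh q Q Hq HQ) as [p [g [Hp0 [Hpf [Hgf [Hg [Hp [Hsqrt Hquad]]]]]]]].
  destruct (bessel_rayleigh_values q Q p Hq HQ Hp0 Hpf) as [P1 [[P2 P2'] [S2 S3]]].
  assert (Hp1 : 0 < p 1%nat).
  { rewrite P1; apply Rdiv_lt_0_compat; [lra|]; repeat apply Rmult_lt_0_compat; lra. }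
  destruct (rayleigh_radius p Hp0 Hp Hsqrt Hquad Hp1 P2 P2')
    as [r [Hr0 [Hr1 [HPr [HPlt [L1 [U1 [L2 U2]]]]]]]].
  assert (Hcv := rayleigh_CV p Hp0 Hp Hsqrt Hp1 P2 P2').
  assert (Hf := CV_radius_bessel q Q Hq HQ).
  assert (Hcvf : forall y, Rbar_lt (Rabs y) (CV_radius (bessel_coef q Q))).
  { intros y; rewrite Hf; exact I. }
  (* The left side is a positive factor times F (1 - P) at x^2; as F does not vanish for x^2 p_1 <
     1, its zeros there are those of 1 - P. *)
  assert (Heq : forall x, 0 < x -> x ^ 2 * p 1%nat <= 1 ->
    x * Derive (jackson_J2 nu q) x - (nu - 2) * jackson_J2 nu q x =
    2 * (qpoch_inf Q q / qpoch_inf q q) * Rpower (x / 2) nu *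
    PSeries (bessel_coef q Q) (x ^ 2) * (1 - PSeries p (x ^ 2))).
  { intros x Hx Hx1; rewrite HJ, (PSeries_log_derivative _ p) by
      first [exact Hx | exact Hpf | apply Hcvf
            | apply Hcv; rewrite Rabs_pos_eq; [exact Hx1 | apply pow2_ge_0]].
    ring. }
  assert (Hrho : sqrt r ^ 2 = r) by (apply pow2_sqrt; lra).
  assert (Hrho0 : 0 < sqrt r) by now apply sqrt_lt_R0.
  (* J is evaluated at the square root of the variable of h, so the root of the Bessel equation is
     the square root of the radius. *)
  exists (sqrt r); rewrite Hrho.
  assert (HQq : 0 < Q * q < 1) by nra.
  assert (HQq2 : 0 < Q * q ^ 2 < 1) by nra.
  assert (Hq3 : 0 < q ^ 3 < 1) by nra.
  assert (HA : 0 < p 1%nat ^ 2 + 3 * p 2%nat) by nra.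
  assert (HB : 0 < 4 * p 3%nat + 3 * p 1%nat * p 2%nat + p 1%nat ^ 3).
  { assert (0 < p 1%nat ^ 3) by now apply pow_lt.
    assert (H3 := Hp 3%nat); nra. }
  split; [exact Hrho0|]; split; [|split; [|split]].
  - rewrite Heq by (rewrite ?Hrho; lra).
    rewrite Hrho, HPr; ring.
  - intros s Hs.
    assert (Hs2 : s ^ 2 < r) by (rewrite <- Hrho; nra).
    assert (Hs3 : s ^ 2 * p 1%nat < 1) by nra.
    rewrite Heq by lra.
    assert (HF := CPSeries_neq0 _ p g Hgf Hg Hp1 Hf (RtoC (s ^ 2))).
    rewrite CPSeries_real, Cmod_R, Rabs_pos_eq in HF by apply pow2_ge_0.
    assert (HP := HPlt (s ^ 2) (conj (pow2_ge_0 s) Hs2)).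
    apply Rmult_integral_contrapositive_currified; [|lra].
    apply Rmult_integral_contrapositive_currified.
    + assert (0 < Rpower (s / 2) nu) by apply exp_pos.
      apply Rgt_not_eq, Rmult_lt_0_compat; lra.
    + intros H0; apply (HF Hs3); rewrite H0; reflexivity.
  - exact (radius_starlike_shift _ p g r Hpf Hgf Hg Hp Hp1 Hcv Hf Hr0 Hr1 HPr HPlt _ Hh).
  - rewrite S2 in HA; rewrite S3 in HB.
    (* That the denominators of the bounds do not vanish is read off from the positivity of the
       power sums in which they occur as factors. *)
    assert (HD : 2 * q - 2 * (Q * q) + Q * q ^ 2 - 3 * q ^ 2 + 2 <> 0).
    { intros H0; rewrite H0 in HA; unfold Rdiv in HA; rewrite Rmult_0_r, Rmult_0_l in HA; lra. }
    rewrite S2 in U1, L2, U2; rewrite S3 in U2; rewrite P1 in L1, U1.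
    match type of HB with context [- (Q ^ 3 * ?n)] => set (N := n) in *; assert (HN : N <> 0) end.
    { intros H0; rewrite H0, Rmult_0_r, Ropp_0 in HB; unfold Rdiv in HB; rewrite Rmult_0_l in HB; lra. }
    split; [|split; [|split]].
    + replace (2 * (1 - q) * (1 - Q) / Q) with (/ (2 * (Q / (4 * (1 - q) * (1 - Q)))))
        by (field; lra); exact L1.
    + match type of U1 with _ < ?u => match goal with |- _ < ?v => replace v with u; [exact U1|] end end.
      field; repeat split; simpl in *; lra.
    + match type of L2 with sqrt ?u < _ => match goal with |- sqrt ?v < _ => replace v with u; [exact L2|] end end.
      field; repeat split; simpl in *; lra.
    + match type of U2 with _ < ?u => match goal with |- _ < ?v => replace v with u; [exact U2|] end end.
      replace (_ / (_ + _)) with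
        ((2 * q - 2 * (Q * q) + Q * q ^ 2 - 3 * q ^ 2 + 2) / N) by (unfold N; f_equal; ring).
      field; repeat split; simpl in *; lra.
Qed.
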